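(* Let $F$ be an alternating shape with $n$ pipes and let $\omega\in\mathfrak S_n$ be sortable on $F$. Then the family $\{\operatorname{lin}(P)\mid P\in\Sigma_F(\omega)\}$ is a partition of the weak order interval $[\mathrm{id},\omega]$.
   Context: Grid cells are unit squares with corners in $\mathbb Z^2$, indexed by their lower-left corner. An alternating shape $F$ (with parameter $n\ge 2$) is a connected finite set of cells whose boundary splits into four paths: a starting path from $(0,0)$ made of $n$ unit steps, each south or east; a NW stair path from $(0,0)$ to $(t_F,t_F)$ with steps $(NE)^{t_F}$, $t_F\ge 0$; an ending path from $(t_F,t_F)$ made of $n$ unit steps, each south or east; and a SE stair path from the endpoint of the starting path to the endpoint of the ending path with steps $(EN)^{b}$, $b\ge0$; the ending path stays strictly north and east of the starting path. A pipe dream on $F$ fills each cell with either a cross (one pipe passing straight horizontally, one straight vertically) or a contact (one elbow joining the west side to the north side, called the NW elbow, and one joining the south side to the east side, called the SE elbow), so that the $n$ pipes entering through the $n$ unit steps of the starting path exit through the $n$ unit steps of the ending path. Pipes are labelled $1,\dots,n$ by their entry step, from northwest to southeast along the starting path; the exit permutation $\omega$ is given by: $\omega(i)$ is the pipe exiting through the $i$-th step of the ending path (counted from northwest to southeast). A pipe dream is reduced if any two pipes cross at most once. $\Pi_F(\omega)$ is the set of reduced pipe dreams on $F$ with exit permutation $\omega$; $\omega$ is sortable on $F$ if $\Pi_F(\omega)\neq\emptyset$. For $a<b$, $(a,b)$ is an inversion of $\omega$ if $\omega^{-1}(b)<\omega^{-1}(a)$ and a noninversion otherwise; the (right) weak order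 is $\omega_1\le\omega_2$ iff the inversion set of $\omega_1$ is contained in that of $\omega_2$. The contact graph $P^{\mathrm{contact}}$ of $P$ is the directed graph on $\{1,\dots,n\}$ with an arc $a\to b$ iff some contact cell of $P$ has pipe $a$ on its NW elbow and pipe $b$ on its SE elbow. The extended contact graph is obtained by adding all arcs $a\to b$ with $(a,b)$ a noninversion of $\omega$. $P$ is strongly acyclic if its extended contact graph is acyclic. $\Sigma_F(\omega)$ is the set of strongly acyclic pipe dreams in $\Pi_F(\omega)$. For $P\in\Sigma_F(\omega)$, $\operatorname{lin}(P)$ is the set of permutations $\pi\in\mathfrak S_n$ such that $\pi^{-1}(a)<\pi^{-1}(b)$ for every arc $a\to b$ of the extended contact graph of $P$. *)

(* Defs.v *)
From mathcomp Require Import all_boot all_order all_fingroup all_algebra finmap.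

Set Implicit Arguments.
Unset Strict Implicit.
Unset Printing Implicit Defensive.

Import Order.TTheory GRing.Theory Num.Theory.

Local Open Scope ring_scope.

(* A cell is named by its lower-left corner. *)
Notation vertex := (int * int)%type.
Notation cell := (int * int)%type.

(* [vedge (x, y)] is the unit edge from (x, y) to (x, y + 1), the west side of
   the cell (x, y); [hedge (x, y)] is the unit edge from (x, y) to (x + 1, y),
   the south side of the cell (x, y). *)
Notation edge := (bool * (int * int))%type.
Definition vedge (v : vertex) : edge := (true, v).
Definition hedge (v : vertex) : edge := (false, v).

Definition north (v : vertex) : vertex := (v.1, v.2 + 1).
Definition south (v : vertex) : vertex := (v.1, v.2 - 1).
Definition east (v : vertex) : vertex := (v.1 + 1, v.2).
Definition west (v : vertex) : vertex := (v.1 - 1, v.2).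

Definition side_W (c : cell) : edge := vedge c.
Definition side_E (c : cell) : edge := vedge (east c).
Definition side_S (c : cell) : edge := hedge c.
Definition side_N (c : cell) : edge := hedge (north c).

Variant step := North | East | South.

Definition move (v : vertex) (d : step) : vertex :=
  match d with North => north v | East => east v | South => south v end.

Definition walk (v : vertex) (s : seq step) : vertex := foldl move v s.

Definition step_edge (v : vertex) (d : step) : edge :=
  match d with
    North => vedge v | East => hedge v | South => vedge (south v)
  end.

Fixpoint path_edges (v : vertex) (s : seq step) : seq edge :=
  if s is d :: s' then step_edge v d :: path_edges (move v d) s' else [::].

Definition south_or_east (d : step) : bool := if d is North then false else true.

Definition NW_stair (t : nat) : seq step := flatten (nseq t [:: North; East]).
Definition SE_stair (b : nat) : seq step := flatten (nseq b [:: East; North]).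

(* Exactly one of the two cells incident to the edge belongs to [F]. *)
Definition boundary_edge (F : {fset cell}) (e : edge) : bool :=
  let: (vertical, v) := e in
  (v \in F) (+) ((if vertical then west v else south v) \in F).

Definition adjacent_cells (c d : cell) : bool :=
  d \in [:: north c; south c; east c; west c].

Definition connected_cells (F : {fset cell}) : bool :=
  [forall c : F, forall d : F,
     connect (fun c' d' : F => adjacent_cells (val c') (val d')) c d].

Record alternating_shape (n : nat) := AlternatingShape {
  cells :> {fset cell};
  start_steps : seq step;
  end_steps : seq step;
  NW_size : nat;
  SE_size : nat;
  start_origin : vertex := (0, 0);
  end_origin : vertex := walk start_origin (NW_stair NW_size);
  start_end : vertex := walk start_origin start_steps;
  size_start_steps : size start_steps = n;
  size_end_steps : size end_steps = n;
  start_steps_SE : all south_or_east start_steps;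
  end_steps_SE : all south_or_east end_steps;
  boundary_closed :
    walk start_end (SE_stair SE_size) = walk end_origin end_steps;
  boundaryE : forall e : edge,
    boundary_edge cells e =
      (e \in path_edges start_origin start_steps
             ++ path_edges start_origin (NW_stair NW_size)
             ++ path_edges end_origin end_steps
             ++ path_edges start_end (SE_stair SE_size));
  (* South and east steps both increase x - y by one, so the k-th vertices of
     the two paths are the points where these meet a common line of slope 1.
     The extremities (k = 0 and k = n) are excluded: there the two paths are
     joined by the stairs, which may be empty. *)
  end_strictly_NE : forall k : nat, (0 < k < n)%N ->
    let p := walk start_origin (take k start_steps) in
    let q := walk end_origin (take k end_steps) in
    (p.1 < q.1) && (p.2 < q.2);
  cells_connected : connected_cells cells
}.

Definition start_edge n (F : alternating_shape n) (i : 'I_n) : edge :=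
  nth (hedge (0, 0)) (path_edges (start_origin F) (start_steps F)) i.

Definition end_edge n (F : alternating_shape n) (i : 'I_n) : edge :=
  nth (hedge (0, 0)) (path_edges (end_origin F) (end_steps F)) i.

(* A filling of [F] with crosses and contacts is given by its set of crosses;
   all the other cells hold contacts. *)
Notation filling F := {set (cells F)}.

(* Pipes travel north and east, so each cell contains two strands: the one
   entering through its west side, [(c, true)], and the one entering through
   its south side, [(c, false)].  In a contact, these are respectively the NW
   elbow and the SE elbow. *)
Notation strand F := (cells F * bool)%type.

Section PipeDreams.
Variables (n : nat) (F : alternating_shape n).
Implicit Types (P : filling F) (c : cells F) (a b : 'I_n).

Definition strand_in (s : strand F) : edge :=
  if s.2 then side_W (val s.1) else side_S (val s.1).

(* A strand leaves through the east side iff it is the horizontal pipe of a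
   cross or the SE elbow of a contact. *)
Definition strand_out P (s : strand F) : edge :=
  if s.2 == (s.1 \in P) then side_E (val s.1) else side_N (val s.1).

Definition strand_next P (s s' : strand F) : bool :=
  strand_out P s == strand_in s'.

Definition in_pipe P a (s : strand F) : bool :=
  [exists s0 : strand F,
     (strand_in s0 == start_edge F a) && connect (strand_next P) s0 s].

Definition exits_through P a (e : edge) : bool :=
  [exists s : strand F, in_pipe P a s && (strand_out P s == e)].

Definition has_exit_perm P (w : 'S_n) : bool :=
  [forall i : 'I_n, exits_through P (w i) (end_edge F i)].

Definition cross_at P a b c : bool :=
  (c \in P) && (in_pipe P a (c, true) && in_pipe P b (c, false)
                || in_pipe P b (c, true) && in_pipe P a (c, false)).

Definition reduced P : bool :=
  [forall a : 'I_n, forall b : 'I_n,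
     (a != b) ==> (#|[set c | cross_at P a b c]| <= 1)%N].

Definition reduced_pipe_dreams (w : 'S_n) : {set filling F} :=
  [set P | has_exit_perm P w && reduced P].

Definition sortable (w : 'S_n) : bool := reduced_pipe_dreams w != set0.

Definition inversion (w : 'S_n) a b : bool :=
  (a < b)%N && ((w^-1)%g b < (w^-1)%g a)%N.

Definition noninversion (w : 'S_n) a b : bool :=
  (a < b)%N && ~~ inversion w a b.

Definition weak_le (w1 w2 : 'S_n) : bool :=
  [forall a, forall b, inversion w1 a b ==> inversion w2 a b].

Definition weak_interval (w1 w2 : 'S_n) : {set 'S_n} :=
  [set p | weak_le w1 p && weak_le p w2].

Definition contact_graph P : rel 'I_n := fun a b =>
  [exists c, [&& c \notin P, in_pipe P a (c, true) & in_pipe P b (c, false)]].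

Definition extended_contact_graph (w : 'S_n) P : rel 'I_n := fun a b =>
  contact_graph P a b || noninversion w a b.

Definition acyclic (r : rel 'I_n) : bool :=
  [forall a, forall b, r a b ==> ~~ connect r b a].

Definition strongly_acyclic_pipe_dreams (w : 'S_n) : {set filling F} :=
  [set P in reduced_pipe_dreams w | acyclic (extended_contact_graph w P)].

Definition lin (w : 'S_n) P : {set 'S_n} :=
  [set p : 'S_n | [forall a, forall b,
     extended_contact_graph w P a b ==> ((p^-1)%g a < (p^-1)%g b)%N]].

End PipeDreams.

Arguments weak_interval {n} w1 w2.

(* Main.v *)
Require Import Defs.
From mathcomp Require Import all_boot all_order all_fingroup all_algebra finmap.
From mathcomp Require Import zify.

(** The combinatorial half knows nothing of the plane: a filling is a subword of a word of adjacent
    transpositions, and being reduced is a bound on numbers of crosses. That a flip preserves this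
    bound is therefore proved by counting and not by following pipes. The geometric half exists to
    reach this model. A shape is given only by its boundary edges, and a pipe only by connectedness
    of strands. The cells must first be recovered as the region between two functions of x - y;
    pipes can then be read as labels of a frontier that moves from the starting path to the ending
    path. A cell on the diagonal 0 or n touches a stair and receives a pipe through one side at
    most, which is why crosses are confined to interior cells. Strong acyclicity does not enter the
    induction: if P is compatible with some pi <= w, then pi itself is a linear extension of the
    extended contact graph. *)

(* A permutation pi lies in lin(P) iff pi <= w and every contact of P has its NW
   pipe before its SE pipe in pi; call such a reduced P compatible with pi.  The
   theorem amounts to: each pi <= w has exactly one compatible P.
   For pi = w, sweeping the cells from southwest to northeast, two pipes must cross
   as soon as they may, which forces every cell; such a P exists because it is a
   reduced pipe dream with earliest possible crosses.
   If pi' is pi with two consecutive values a, b exchanged, where w inverts a and b,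
   then the pipe dreams without contact of a and b are compatible with pi iff they
   are with pi', and exchanging the cross of a and b with their farthest contact
   is a bijection between the other compatible pipe dreams.  A chain of such
   exchanges goes from w down to any pi <= w. *)

Set Implicit Arguments.
Unset Strict Implicit.
Unset Printing Implicit Defensive.

(** * Sweeping a word of adjacent transpositions *)

Lemma perm_inv_eq (T : finType) (s : {perm T}) x y : ((s^-1)%g x == y) = (x == s y).
Proof. by rewrite -(inj_eq (@perm_inj _ s)) permKV. Qed.

(** No third value lies between [i] and [j], so exchanging them reverses no other pair. *)
Lemma tperm_adjacent_lt n (i j x y : 'I_n) : j = i.+1 :> nat -> x != y ->
  (tperm i j x < tperm i j y) = (x < y) (+) ((x, y) \in [:: (i, j); (j, i)]).
Proof.
move=> ij; rewrite !inE !xpair_eqE -!val_eqE /= => xy.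
by case: tpermP => [->|->|/eqP + /eqP +]; case: tpermP => [->|->|/eqP + /eqP +];
  rewrite -?val_eqE /=; lia.
Qed.

Lemma mem_split (T : eqType) (x : T) s : x \in s -> exists l l', s = l ++ x :: l'.
Proof. by case/splitPr=> l l'; exists l, l'. Qed.

(** Meant for ranks in the sweep: [j] of the cross of two pipes, [i] of their farthest contact, [k]
    of another contact on the same side of the cross. *)
Lemma farthest_between (i j k : nat) : i != k -> j != k -> (j < i) = (j < k) ->
  (k - j) + (j - k) <= (i - j) + (j - i) -> (i < k <= j) || (j < k <= i).
Proof.
move=> ik jk side far; have [lt_jk|le_kj] := ltnP j k; rewrite ?lt_jk in side *.
  by apply/orP; right; lia.
by apply/orP; left; apply/andP; split; lia.
Qed.

Lemma between_antisym (i j k : nat) :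
  (i < j <= k) || (k < j <= i) -> (i < k <= j) || (j < k <= i) -> j = k.
Proof. by case/orP=> /andP[? ?] /orP[] /andP[? ?]; lia. Qed.

Section Sweep.
Variables (n : nat) (C : finType) (cs : seq C) (inner : pred C) (p q : C -> 'I_n).
Hypothesis cs_uniq : uniq cs.
Hypothesis mem_cs : forall c, c \in cs.
Hypothesis pq_adjacent : forall c, inner c -> q c = (p c).+1 :> nat.
Implicit Types (P : {set C}) (s w pi : 'S_n) (a b : 'I_n) (c d : C) (l : seq C).

(* [cs] lists the cells in the order in which they are swept, each cell acting on the
   two neighbouring positions [p c] and [q c] of the frontier, where the pipes enter
   through its west and south sides.  Cells that are not [inner] touch only one
   position, and may not hold a cross.  A state maps positions to pipes. *)
Definition cell_step P s c := if c \in P then (tperm (p c) (q c) * s)%g else s.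
Definition state P l := foldl (cell_step P) 1%g l.
Definition state_at P c := state P (take (index c cs) cs).
Definition upper P c := state_at P c (p c).
Definition lower P c := state_at P c (q c).
Definition meets P (x : 'I_n * 'I_n) c :=
  x \in [:: (upper P c, lower P c); (lower P c, upper P c)].
Definition crosses P x c := (c \in P) && meets P x c.

Definition legal P := P \subset inner.

Lemma state_rcons P l c : state P (rcons l c) = cell_step P (state P l) c.
Proof. by rewrite /state foldl_rcons. Qed.

Lemma state_at_split P l c l' : cs = l ++ c :: l' -> state_at P c = state P l.
Proof.
move=> E; move: cs_uniq; rewrite /state_at E cat_uniq /= negb_or.
case/and3P=> _ /andP[/negbTE cl _] _.
by rewrite index_cat cl /= eqxx addn0 take_size_cat.
Qed.

Lemma inner_neq c : inner c -> p c != q c.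
Proof. by move/pq_adjacent=> e; rewrite -val_eqE /= e; lia. Qed.

Lemma upper_neq_lower P c : inner c -> upper P c != lower P c.
Proof. by move/inner_neq; rewrite (inj_eq perm_inj). Qed.

Lemma upper_before_lower P c : inner c ->
  ((state_at P c)^-1%g (upper P c) < (state_at P c)^-1%g (lower P c)).
Proof. by move=> ic; rewrite !permK pq_adjacent. Qed.

Lemma crosses_diag P a c : legal P -> crosses P (a, a) c = false.
Proof.
move=> prP; apply: contraTF isT => /andP[/(subsetP prP)/(upper_neq_lower P) ul].
by rewrite /meets !inE !xpair_eqE => /orP[] /andP[/eqP ua /eqP la];
  rewrite -ua -la eqxx in ul.
Qed.

(** A cross exchanges neighbouring positions, which reverses its own two pipes on the frontier and
    no other pair; hence only the parity of their crosses matters. *)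
Lemma state_order P a b l l' : legal P -> cs = l ++ l' ->
  ((state P l)^-1%g a < (state P l)^-1%g b)
  = (a < b) (+) odd (count (crosses P (a, b)) l).
Proof.
move=> prP; have [<-|ab] := eqVneq a b.
  by rewrite !ltnn (eq_count (a2 := pred0)) ?count_pred0 // => c; rewrite crosses_diag.
elim/last_ind: l l' => [|l c IH] l' E.
  by rewrite /state /= invg1 !perm1 addbF.
rewrite cat_rcons in E; rewrite -cats1 count_cat cats1 state_rcons oddD addbA -(IH _ E) /= addn0.
rewrite /cell_step /crosses; case: ifP => cP /=; last by rewrite addbF.
have ic : inner c by apply: (subsetP prP).
rewrite invMg tpermV !permM tperm_adjacent_lt ?pq_adjacent ?(inj_eq perm_inj) //.
rewrite oddb /meets /upper /lower (state_at_split _ E) !inE !xpair_eqE.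
by rewrite !perm_inv_eq [(a == _) && (b == _) in RHS]andbC //; do !case: eqP.
Qed.

(** * Toggling two cells where the same pipes meet *)

Definition flip P c d : {set C} := [set x | (x \in P) (+) (x \in [set c; d])].

Lemma meetsE P a b c :
  meets P (a, b) c = ((upper P c, lower P c) \in [:: (a, b); (b, a)]).
Proof. by rewrite /meets !inE !xpair_eqE; do !case: eqP => //; congruence. Qed.

(** Conjugation by the state turns an exchange of positions into an exchange of pipes. The latter
    acts on the right and so commutes with all later steps, which act on the left; this is what
    makes [state_flip] work. *)
Lemma mul_tperm_meets P c a b : meets P (a, b) c ->
  (tperm (p c) (q c) * state_at P c = state_at P c * tperm a b)%g.
Proof.
rewrite meetsE conjgC tpermJ -/(upper P c) -/(lower P c).
by rewrite !inE => /orP[] /eqP[-> ->]; rewrite // tpermC.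
Qed.

Lemma prefix_index l e l' : cs = l ++ e :: l' ->
  index e cs = size l /\ forall x, (x \in l) = (index x cs < index e cs).
Proof.
move=> E; have idxe : index e cs = size l.
  move: cs_uniq; rewrite E cat_uniq /= negb_or => /and3P[_ /andP[/negbTE el _] _].
  by rewrite index_cat el /= eqxx addn0.
split=> // x; rewrite idxe {1}E index_cat; case: ifPn => xl.
  by rewrite index_mem xl.
by rewrite ltnNge leq_addr.
Qed.

Lemma state_flip P c d a b l l' : cs = l ++ l' ->
    index c cs < index d cs -> meets P (a, b) c -> meets P (a, b) d ->
  state (flip P c d) l
  = (state P l * (if (c \in l) && (d \notin l) then tperm a b else 1))%g.
Proof.
move=> E cd mc md; elim/last_ind: l l' E => [|l e IH] l' E; first by rewrite mulg1.
rewrite cat_rcons in E; rewrite !state_rcons (IH _ E) !mem_rcons !inE.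
have [_ mem_l] := prefix_index E; rewrite !mem_l.
have step P1 s1 s2 : (cell_step P1 (s1 * s2) e = cell_step P1 s1 e * s2)%g.
  by rewrite /cell_step; case: ifP; rewrite ?mulgA.
have cNd : c != d by apply: contraTneq cd => ->; rewrite ltnn.
rewrite step /cell_step !inE.
have [ec|ec] := eqVneq e c.
  subst e; rewrite ltnn [d == c]eq_sym (negbTE cNd) /= addbT ltnNge (ltnW cd) /= mulg1.
  have := mul_tperm_meets mc; rewrite (state_at_split _ E) => h.
  by case: (c \in P); rewrite /= ?h // -mulgA tperm2 mulg1.
have [ed|ed] := eqVneq e d.
  subst e; rewrite cd ltnn !orbT /= addbT mulg1.
  have := mul_tperm_meets md; rewrite (state_at_split _ E) => h.
  by case: (d \in P); rewrite /= ?h // -?mulgA ?tperm2 ?mulg1.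
by rewrite addbF.
Qed.

Lemma state_at_flip P c d a b e :
    index c cs < index d cs -> meets P (a, b) c -> meets P (a, b) d ->
  state_at (flip P c d) e = (state_at P e *
    (if index c cs < index e cs <= index d cs then tperm a b else 1))%g.
Proof.
move=> cd mc md; have [l [l' E]] := mem_split (mem_cs e).
by rewrite !(state_at_split _ E) (state_flip E cd mc md) !(prefix_index E).2 -leqNgt.
Qed.

Lemma state_flip_cs P c d a b :
    index c cs < index d cs -> meets P (a, b) c -> meets P (a, b) d ->
  state (flip P c d) cs = state P cs.
Proof.
move=> cd mc md; rewrite (state_flip (esym (cats0 cs)) cd mc md).
by rewrite !mem_cs mulg1.
Qed.

(** The sum runs over ordered pairs, so each cross is counted once for each order of its two
    pipes. *)
Lemma sum_crosses P : legal P ->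
  \sum_x count (crosses P x) cs = #|P|.*2.
Proof.
move=> prP; transitivity (\sum_x \sum_c (crosses P x c : nat)).
  apply: eq_bigr => x _; rewrite -sum1_count big_mkcond (big_uniq _ cs_uniq).
  by apply: eq_big => [c|c _]; [rewrite mem_cs | case: crosses].
rewrite exchange_big /= -sum1_card [in RHS]big_mkcond -mul2n big_distrr /=.
apply: eq_bigr => c _; transitivity #|[pred x | crosses P x c]|.
  by rewrite -sum1_card [in RHS]big_mkcond; apply: eq_bigr => x _; rewrite !inE; case: crosses.
case: ifP => cP; last by apply: eq_card0 => x; rewrite !inE /crosses cP.
have ul : upper P c != lower P c by apply: upper_neq_lower; apply: (subsetP prP).
rewrite -[RHS]/(size [:: (upper P c, lower P c); (lower P c, upper P c)]).
rewrite -[RHS](elimT card_uniqP) ?muln1 //.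
  by apply: eq_card => x; rewrite !inE /crosses cP /meets !inE.
by rewrite /= andbT inE xpair_eqE negb_and ul.
Qed.

(** The abstract form of [reduced_pipe_dreams]. Including the pairs [(a, a)] is harmless, by
    [crosses_diag]. *)
Definition dreams w : {set {set C}} :=
  [set P | [&& legal P, state P cs == w & [forall x, count (crosses P x) cs <= 1]]].

Lemma dreams_order P w a b : P \in dreams w ->
  odd (count (crosses P (a, b)) cs) = (a < b) (+) (w^-1%g a < w^-1%g b).
Proof.
rewrite inE => /and3P[prP /eqP <- _].
by rewrite (state_order a b prP (esym (cats0 cs))) addbA addbb.
Qed.

Lemma card_flip P c d : (c \in P) != (d \in P) -> #|flip P c d| = #|P|.
Proof.
wlog cP : c d / c \in P => [IH cd|].
  have [cP|cP] := boolP (c \in P); first exact: IH.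
  rewrite -(IH d c) 1?eq_sym //; last by move: cd; rewrite (negbTE cP); case: (d \in P).
  by apply: eq_card => x; rewrite !inE orbC.
rewrite cP; case: (boolP (d \in P)) => // dP _.
have -> : flip P c d = d |: (P :\ c).
  apply/setP=> x; rewrite !inE; have [->|xd] := eqVneq x d; first by rewrite orbT (negbTE dP).
  by have [->|xc] := eqVneq x c; rewrite ?cP ?addbF.
by rewrite cardsU1 !inE (negbTE dP) andbF (cardsD1 c P) cP.
Qed.

(* The flip keeps the number of crosses and the parity, dictated by [w], of the number
   of crosses of each pair of pipes.  As the crosses of [P] were as few as these
   parities allow, so are the new ones. *)
Lemma flip_dreams P w c d a b : P \in dreams w ->
    index c cs < index d cs -> inner c -> inner d ->
    meets P (a, b) c -> meets P (a, b) d -> (c \in P) != (d \in P) ->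
  flip P c d \in dreams w.
Proof.
move=> Pw; have := Pw; rewrite inE => /and3P[prP /eqP Pcs /forallP redP].
move=> cd ic id mc md Pcd.
have prF : legal (flip P c d).
  apply/subsetP=> e; rewrite !inE; have [->|_] := eqVneq e c => //.
  by have [->|_] := eqVneq e d => //; rewrite addbF => /(subsetP prP).
have Fcs : state (flip P c d) cs = w by rewrite (state_flip_cs cd mc md).
rewrite inE prF Fcs eqxx; apply/forallP.
pose N x := count (crosses (flip P c d) x) cs.
have oddN x : odd (N x) = count (crosses P x) cs :> nat.
  case: x => x y; have := redP (x, y).
  have -> : odd (N (x, y)) = odd (count (crosses P (x, y)) cs).
    apply: (@addbI (x < y)); rewrite (dreams_order x y Pw) addKb -Fcs.
    by rewrite (state_order x y prF (esym (cats0 cs))).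
  by case: count => [|[]].
have leN x : odd (N x) <= N x ?= iff (odd (N x) == N x :> nat).
  by split=> //; case: (N x) => [|m] //; case: odd.
have := leqif_sum (P := xpredT) (fun x _ => leN x).
rewrite (eq_bigr _ (fun x _ => oddN x)) !sum_crosses // card_flip // => -[_].
rewrite eqxx => /esym/forallP eqN x.
by rewrite -[count _ _]/(N x) -(eqP (eqN x)); case: odd.
Qed.

(** A cell that is not inner stands for a cell along a stair, whose contact gives no arc of the
    contact graph; its positions are meaningless here. *)
Definition compatible pi P :=
  [forall c, inner c && (c \notin P) ==> (pi^-1%g (upper P c) < pi^-1%g (lower P c))].
Definition compatible_dreams w pi := [set P in dreams w | compatible pi P].

(** Strict at the cell swept first and large at the other, because [state_at] is the state just
    before a cell is swept. *)
Definition between c d e :=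
  (index c cs < index e cs <= index d cs) || (index d cs < index e cs <= index c cs).

Lemma flipC P c d : flip P c d = flip P d c.
Proof. by apply/setP=> x; rewrite !inE orbC. Qed.

Lemma flipK P c d : flip (flip P c d) c d = P.
Proof. by apply/setP=> x; rewrite !inE addbK. Qed.

Lemma index_neq c d : c != d -> (index c cs < index d cs) || (index d cs < index c cs).
Proof. by rewrite -neq_ltn; apply: contraNneq => /index_inj ->. Qed.

Lemma state_at_flip_between P c d a b e : c != d ->
    meets P (a, b) c -> meets P (a, b) d ->
  state_at (flip P c d) e = (state_at P e * (if between c d e then tperm a b else 1))%g.
Proof.
rewrite /between => /index_neq/orP[] cd mc md.
  rewrite (state_at_flip _ cd mc md); case: ifP => // _; case: ifP => //; lia.
rewrite flipC (state_at_flip _ cd md mc) orbC; case: ifP => // _; case: ifP => //; lia.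
Qed.

Lemma flip_dreams_neq P w c d a b : P \in dreams w ->
    inner c -> inner d -> meets P (a, b) c -> meets P (a, b) d ->
    c \notin P -> d \in P ->
  flip P c d \in dreams w.
Proof.
move=> Pw ic id mc md cP dP.
have cNd : c != d by apply: contraNneq cP => ->.
have /orP[cd|cd] := index_neq cNd.
  by apply: flip_dreams Pw cd ic id mc md _; rewrite (negbTE cP) dP.
by rewrite flipC; apply: flip_dreams Pw cd id ic md mc _; rewrite (negbTE cP) dP.
Qed.

Lemma dreams_cross_uniq P w x c d : P \in dreams w ->
  crosses P x c -> crosses P x d -> c = d.
Proof.
rewrite inE => /and3P[_ _ /forallP/(_ x)]; rewrite -size_filter => h xc xd.
have: c \in filter (crosses P x) cs by rewrite mem_filter xc mem_cs.
have: d \in filter (crosses P x) cs by rewrite mem_filter xd mem_cs.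
by case: filter h => [|y [|]] //= _; rewrite !inE => /eqP -> /eqP ->.
Qed.

(** The pipes keep their initial order up to their only cross [d] and are reversed after it; at [d]
    itself the strict comparison gives the order on arrival. *)
Lemma upper_order P w c d a b : P \in dreams w -> inner c ->
    meets P (a, b) c -> crosses P (a, b) d ->
  (upper P c == a) = (a < b) (+) (index d cs < index c cs).
Proof.
move=> Pw ic mc xd; have := Pw; rewrite inE => /and3P[prP _ _].
have [l [l' E]] := mem_split (mem_cs c).
have -> : (index d cs < index c cs) = odd (count (crosses P (a, b)) l).
  rewrite -(prefix_index E).2.
  have -> : count (crosses P (a, b)) l = count_mem d l.
    apply: eq_in_count => e _ /=; apply/idP/eqP => [xe|-> //].
    exact: dreams_cross_uniq Pw xe xd.
  have: uniq l by move: cs_uniq; rewrite E cat_uniq => /andP[].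
  by move/count_uniq_mem ->; case: (_ \in _).
rewrite -(state_order a b prP E) -(state_at_split P E).
have := upper_before_lower P ic; have := upper_neq_lower P ic.
move: mc; rewrite meetsE !inE !xpair_eqE => /orP[] /andP[/eqP -> /eqP ->].
  by rewrite eqxx => _ ->.
by move=> /negbTE -> /ltnW; rewrite leqNgt => /negbTE ->.
Qed.

(** * The dream compatible with the exit permutation *)

(** The exit order tells the two kinds of cells apart. A cross is the only one of its pair, so its
    pipes exit reversed; compatibility makes the pipes of a contact exit in their current order. The
    state before [c] thus decides [c]. *)
Lemma compatible_mem P w c : P \in compatible_dreams w w -> inner c ->
  (c \in P) = (w^-1%g (lower P c) < w^-1%g (upper P c)).
Proof.
rewrite inE => /andP[Pw /forallP/(_ c)] + ic; rewrite ic /=.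
case: (boolP (c \in P)) => cP /=; last by move/ltnW; rewrite leqNgt => /negbTE ->.
move=> _; set a := upper P c; set b := lower P c.
have mc : meets P (a, b) c by rewrite /meets inE eqxx.
have xc : crosses P (a, b) c by rewrite /crosses cP.
have ab : a != b by apply: upper_neq_lower.
have := upper_order Pw ic mc xc; rewrite eqxx ltnn addbF => lt_ab.
have := dreams_order a b Pw; rewrite -lt_ab.
have -> : count (crosses P (a, b)) cs = 1.
  move: (Pw); rewrite inE => /and3P[_ _ /forallP/(_ (a, b))].
  have: has (crosses P (a, b)) cs by apply/hasP; exists c.
  by rewrite has_count; case: count => [|[]].
move=> /esym; rewrite addTb -leqNgt leq_eqVlt => /orP[|->] //.
by rewrite (inj_eq val_inj) (inj_eq perm_inj) eq_sym (negbTE ab).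
Qed.

Lemma compatible_dreams_self_uniq w P1 P2 :
  P1 \in compatible_dreams w w -> P2 \in compatible_dreams w w -> P1 = P2.
Proof.
move=> w1 w2.
have pr P : P \in compatible_dreams w w -> legal P by rewrite !inE => /andP[/and3P[]].
have eq_cell l c l' : cs = l ++ c :: l' -> state P1 l = state P2 l ->
    (c \in P1) = (c \in P2).
  move=> E eq_l; have [ic|nic] := boolP (inner c); last first.
    have notin P : P \in compatible_dreams w w -> (c \in P) = false.
      by move=> Pw; apply: contraNF nic => /(subsetP (pr _ Pw)).
    by rewrite !notin.
  rewrite (compatible_mem w1 ic) (compatible_mem w2 ic) /upper /lower.
  by rewrite !(state_at_split _ E) eq_l.
have eq_state l l' : cs = l ++ l' -> state P1 l = state P2 l.
  elim/last_ind: l l' => [//|l c IH] l'; rewrite cat_rcons => E.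
  by rewrite !state_rcons /cell_step (eq_cell _ _ _ E) (IH _ E).
apply/setP=> c; have [l [l' E]] := mem_split (mem_cs c).
exact: eq_cell E (eq_state _ _ E).
Qed.

(** A dream whose crosses have the least sum of ranks is compatible: a bad contact is followed by a
    cross of the same pipes, and flipping the two would lower the sum. *)
Lemma compatible_dreams_self_exists w P0 : P0 \in dreams w ->
  exists P, P \in compatible_dreams w w.
Proof.
move=> w0; pose f P := \sum_(c in P) index c cs.
have [P Pw' minP] := arg_minnP f w0.
have {Pw'}Pw : P \in dreams w := Pw'.
exists P; rewrite inE Pw; apply/forallP=> c; apply/implyP=> /andP[ic cP]; apply: contraT => bad.
move: (Pw); rewrite inE => /and3P[prP _ _].
set a := upper P c in bad *; set b := lower P c in bad *.
have mc : meets P (a, b) c by rewrite /meets inE eqxx.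
have [l [l' E]] := mem_split (mem_cs c).
have [d dl' xd] : exists2 d, d \in l' & crosses P (a, b) d.
  (* Without a later cross the pipes would exit in the order they have at [c], against [bad]. *)
  apply/hasP; rewrite has_count lt0n; apply: contraNneq bad => l'0.
  have := upper_before_lower P ic; rewrite (state_at_split P E) -/a -/b.
  rewrite (state_order a b prP E).
  have -> : count (crosses P (a, b)) l = count (crosses P (a, b)) cs.
    by rewrite [in RHS]E count_cat /= l'0 /crosses (negbTE cP) !addn0.
  by rewrite (dreams_order a b Pw) addKb.
have /andP[dP md] := xd.
have id : inner d := subsetP prP d dP.
have cd : index c cs < index d cs.
  have [_ memE] := prefix_index E; rewrite ltn_neqAle; apply/andP; split.
    by apply: contraNneq cP => /index_inj ->; rewrite ?mem_cs.
  rewrite leqNgt -memE; apply/negP => dl.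
  move: cs_uniq; rewrite E cat_uniq => /and3P[_ /hasP[]].
  by exists d; rewrite ?inE ?dl' ?orbT.
have := minP _ (flip_dreams_neq Pw ic id mc md cP dP).
have -> : flip P c d = c |: (P :\ d).
  apply/setP=> x; rewrite !inE; have [->|xc] := eqVneq x c; first by rewrite (negbTE cP).
  by have [->|xd'] := eqVneq x d; rewrite ?dP ?addbF.
rewrite /f big_setU1 ?inE ?(negbTE cP) ?andbF //= (big_setD1 d dP) /= leq_add2r.
by rewrite leqNgt cd.
Qed.

(** * Exchanging two consecutive values of pi *)

Lemma meets_flip P c d a b e : c != d ->
    meets P (a, b) c -> meets P (a, b) d ->
  meets (flip P c d) (a, b) e = meets P (a, b) e.
Proof.
move=> cNd mc md; rewrite !meetsE /upper /lower (state_at_flip_between _ cNd mc md) !permM.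
case: ifP => _; last by rewrite !perm1.
rewrite !inE !xpair_eqE; do 2!case: tpermP => // ?; subst; rewrite ?eqxx //;
  do !case: eqP => //; congruence.
Qed.

(** Going from [pi] to [pi'], only the precedence of [a] over [b] may be lost. This is what
    exchanging two consecutive values amounts to, and it is used in both directions. *)
Definition adjacent_from pi pi' a b := forall x y, (x, y) != (a, b) ->
  (pi^-1%g x < pi^-1%g y) -> (pi'^-1%g x < pi'^-1%g y).

(* The cross of [a] and [b] is exchanged with their farthest contact, so that all their
   other contacts lie in between and get [a] and [b] swapped. *)
Lemma compatible_step P w pi a b : let pi' := (pi * tperm a b)%g in
    a != b -> adjacent_from pi pi' a b ->
    (a < b) (+) (w^-1%g a < w^-1%g b) ->
    (pi^-1%g a < pi^-1%g b) -> P \in compatible_dreams w pi ->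
  P \in compatible_dreams w pi' \/
  exists c d, [/\ inner c, inner d, c \notin P, d \in P &
    [/\ meets P (a, b) c, meets P (a, b) d & flip P c d \in compatible_dreams w pi']].
Proof.
move=> pi' ab adj inv_ab pi_ab; rewrite inE => /andP[Pw /forallP compP].
have pi'E x : pi'^-1%g x = pi^-1%g (tperm a b x) by rewrite invMg tpermV permM.
have {compP} comp e : inner e -> e \notin P -> pi^-1%g (upper P e) < pi^-1%g (lower P e).
  by move=> ie eP; have := compP e; rewrite ie eP.
pose contact c := [&& inner c, c \notin P, upper P c == a & lower P c == b].
have [c0 con0 | no_contact] := pickP contact; last first.
  left; rewrite inE Pw; apply/forallP=> e; apply/implyP=> /andP[ie eP].
  apply: adj; last exact: comp.
  by have := no_contact e; rewrite /contact ie eP xpair_eqE /= => ->.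
right.
(* [inv_ab] says that the number of crosses of [a] and [b] is odd. *)
have /hasP[d _ xd] : has (crosses P (a, b)) cs.
  by rewrite has_count -(dreams_order a b Pw) in inv_ab *; case: count inv_ab.
have /andP[dP md] := xd.
have id : inner d by move: Pw; rewrite inE => /and3P[/subsetP prP _ _]; apply: prP.
pose dist c := (index c cs - index d cs) + (index d cs - index c cs).
have [c /and4P[ic cP /eqP uc /eqP lc] maxc] := arg_maxnP dist con0.
have mc : meets P (a, b) c by rewrite meetsE uc lc inE eqxx.
have cNd : c != d by apply: contraNneq cP => ->.
exists c, d; split=> //; split=> //.
rewrite inE (flip_dreams_neq Pw ic id mc md cP dP).
apply/forallP=> e; apply/implyP=> /andP[ie].
rewrite !inE negb_add => eF.
have := upper_order Pw ic mc xd; rewrite uc eqxx => /esym side_c.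
rewrite /upper /lower (state_at_flip_between _ cNd mc md) !permM -/(upper P e) -/(lower P e).
(* The new contact at [d] has [b] as its NW pipe in either case: if [c] precedes [d], the pipes now
   arrive exchanged; otherwise [b] was already above [a] at [d]. *)
have [ed|eNd] := eqVneq e d.
  subst e; have := upper_order Pw id md xd; rewrite ltnn addbF.
  have := upper_neq_lower P id; move: md; rewrite meetsE !inE !xpair_eqE /between ltnn leqnn.
  move=> /orP[] /andP[/eqP -> /eqP ->].
    rewrite eqxx => _ /esym lt_ab; move: side_c; rewrite lt_ab /= -leqNgt leq_eqVlt.
    case/orP=> [/eqP/index_inj cd|->]; first by rewrite cd ?eqxx ?mem_cs in cNd.
    by rewrite !pi'E !tpermK.
  move=> /negbTE -> /esym lt_ab; move: side_c; rewrite lt_ab /= => dc.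
  by rewrite [index c cs < _]ltnNge (ltnW dc) /= !perm1 !pi'E tpermL tpermR.
have eNc : e != c by apply: contraTneq eF => ->; rewrite eqxx (negbTE cP).
have eP : e \notin P by move: eF; rewrite (negbTE eNc) (negbTE eNd) => /eqP ->.
(* Between [c] and [d] the two pipes are exchanged in the cells as well as in [pi'], so nothing
   changes. Elsewhere only a contact with [a] above [b] could fail; it would be on the same side of
   [d] as [c] and no farther, hence between them. *)
case: ifP => bt; first by rewrite !pi'E !tpermK; apply: comp.
rewrite !perm1; apply: adj; last exact: comp.
apply: contraFneq bt => -[ue le].
have me : meets P (a, b) e by rewrite meetsE ue le inE eqxx.
have := upper_order Pw ie me xd; rewrite ue eqxx => /esym side_e.
apply: farthest_between; last by apply: maxc; rewrite /contact ie eP ue le !eqxx.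
- by apply: contraNneq eNc => /index_inj ->; rewrite ?mem_cs.
- by apply: contraNneq eNd => /index_inj ->; rewrite ?mem_cs.
- by apply: (@addbI (a < b)); rewrite side_c side_e.
Qed.

Lemma compatible_upper P w pi a b c : P \in compatible_dreams w pi ->
    inner c -> c \notin P -> meets P (a, b) c -> (pi^-1%g a < pi^-1%g b) ->
  upper P c = a.
Proof.
rewrite inE => /andP[_ /forallP/(_ c)] + ic cP; rewrite ic cP /= meetsE !inE !xpair_eqE.
by move=> lt_ul /orP[] /andP[/eqP ue /eqP le] //;
  rewrite ue le ltnNge in lt_ul * => /ltnW; rewrite (negbTE lt_ul).
Qed.

(** Both dreams lead to the same dream [Q] for [pi'], from which the way back is determined. If [Q]
    has a contact of [a] and [b], it comes from a flip: [c] is the cross of these pipes in [Q], and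
    [d] is recovered because two candidates would each lie between [c] and the other. *)
Lemma compatible_step_uniq w pi a b P1 P2 : let pi' := (pi * tperm a b)%g in
    a != b -> adjacent_from pi pi' a b ->
    (a < b) (+) (w^-1%g a < w^-1%g b) -> (pi^-1%g a < pi^-1%g b) ->
    {in compatible_dreams w pi' &, forall Q1 Q2, Q1 = Q2} ->
  P1 \in compatible_dreams w pi -> P2 \in compatible_dreams w pi -> P1 = P2.
Proof.
move=> pi' ab adj inv_ab pi_ab uniq' P1pi P2pi.
have pi'E x : pi'^-1%g x = pi^-1%g (tperm a b x) by rewrite invMg tpermV permM.
have pi'_ba : pi'^-1%g b < pi'^-1%g a by rewrite !pi'E tpermL tpermR.
have meetC P c : meets P (a, b) c = meets P (b, a) c.
  by rewrite !meetsE !inE !xpair_eqE orbC.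
(* A contact [e] of both [P] and [Q] has [a] above in [P] but [b] above in [Q], so the flip
   exchanged the pipes there. *)
have flip_contact P Q c d : P \in compatible_dreams w pi -> Q \in compatible_dreams w pi' ->
    inner c -> inner d -> c != d -> meets P (a, b) c -> meets P (a, b) d -> Q = flip P c d ->
    forall e, inner e -> e \notin Q -> e != d -> meets Q (a, b) e -> e != c -> between c d e.
  move=> Ppi Qpi' ic id cNd mc md QE e ie eQ eNd me eNc.
  have eP : e \notin P by move: eQ; rewrite QE !inE (negbTE eNc) (negbTE eNd) addbF.
  have meP : meets P (a, b) e by rewrite QE meets_flip in me.
  have uP := compatible_upper Ppi ie eP meP pi_ab.
  rewrite meetC in me; have := compatible_upper Qpi' ie eQ me pi'_ba.
  rewrite /upper QE (state_at_flip_between _ cNd mc md) permM -/(upper P e) uP.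
  by case: ifP => // _; rewrite perm1 => /eqP; rewrite (negbTE ab).
have no_contact P c : P \in compatible_dreams w pi -> P \in compatible_dreams w pi' ->
    inner c -> c \notin P -> meets P (a, b) c -> False.
  move=> Ppi Ppi' ic cP mc; have := compatible_upper Ppi ic cP mc pi_ab.
  rewrite meetC in mc; rewrite (compatible_upper Ppi' ic cP mc pi'_ba) => /eqP.
  by rewrite eq_sym (negbTE ab).
have flip_at P c d : c \notin P -> d \in P -> meets P (a, b) c -> meets P (a, b) d ->
    [/\ c != d, c \in flip P c d, d \notin flip P c d,
        meets (flip P c d) (a, b) c & meets (flip P c d) (a, b) d].
  move=> cP dP mc md; have cNd : c != d by apply: contraNneq cP => ->.
  by rewrite !meets_flip // !inE !eqxx orbT dP (negbTE cP).
have [P1pi'|[c1 [d1 [ic1 id1 cP1 dP1 [mc1 md1 F1]]]]] := compatible_step ab adj inv_ab pi_ab P1pi;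
have [P2pi'|[c2 [d2 [ic2 id2 cP2 dP2 [mc2 md2 F2]]]]] := compatible_step ab adj inv_ab pi_ab P2pi.
- exact: uniq'.
- have [_ _ d2F _ md2F] := flip_at _ _ _ cP2 dP2 mc2 md2.
  by have E := uniq' _ _ P1pi' F2; rewrite -E in d2F md2F; case: (no_contact P1 d2).
- have [_ _ d1F _ md1F] := flip_at _ _ _ cP1 dP1 mc1 md1.
  by have E := uniq' _ _ P2pi' F1; rewrite -E in d1F md1F; case: (no_contact P2 d1).
have E := uniq' _ _ F1 F2.
have [cNd1 c1F d1F mc1F md1F] := flip_at _ _ _ cP1 dP1 mc1 md1.
have [cNd2 c2F d2F mc2F md2F] := flip_at _ _ _ cP2 dP2 mc2 md2.
have c12 : c1 = c2.
  move: (F1); rewrite inE => /andP[F1d _].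
  apply: (dreams_cross_uniq F1d (x := (a, b))); first by rewrite /crosses c1F.
  by rewrite E /crosses c2F.
subst c2.
have [d12|dNd] := eqVneq d1 d2.
  by rewrite -(flipK P1 c1 d1) E d12 flipK.
rewrite -E in d2F md2F.
have := flip_contact _ _ _ _ P1pi F1 ic1 id1 cNd1 mc1 md1 erefl d2 id2 d2F.
rewrite eq_sym => /(_ dNd md2F); rewrite eq_sym => /(_ cNd2).
rewrite E in d1F md1F.
have := flip_contact _ _ _ _ P2pi F2 ic1 id2 cNd2 mc2 md2 erefl d1 id1 d1F dNd md1F.
rewrite eq_sym => /(_ cNd1) d1_bt d2_bt; apply/eqP; move: dNd; apply: contraNT => _.
by apply/eqP/index_inj; rewrite ?mem_cs //; apply: between_antisym d1_bt d2_bt.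
Qed.

Lemma adjacent_from_tperm pi a b : pi^-1%g b = (pi^-1%g a).+1 :> nat ->
  adjacent_from pi (pi * tperm a b)%g a b /\
  adjacent_from (pi * tperm a b)%g (pi * tperm a b * tperm b a)%g b a.
Proof.
move=> ab.
have piE x : (pi * tperm a b)^-1%g x = tperm (pi^-1%g a) (pi^-1%g b) (pi^-1%g x).
  by rewrite invMg tpermV permM inj_tperm //; apply: perm_inj.
have -> : (pi * tperm a b * tperm b a)%g = pi by rewrite -mulgA tpermC tperm2 mulg1.
by split=> x y; have [->|xy] := eqVneq x y; rewrite ?ltnn // !piE tperm_adjacent_lt
  ?(inj_eq perm_inj) // !inE !xpair_eqE !(inj_eq perm_inj);
  do !case: eqP => //= ?; subst; rewrite ?addbF // ab; lia.
Qed.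

(** Monotonicity gives [i <= u i] for all [i], and both sides have the same sum. *)
Lemma perm_increasing_eq1 (u : 'S_n) :
  (forall i j : 'I_n, j = i.+1 :> nat -> u i < u j) -> u = 1%g.
Proof.
move=> inc; have le_u m (i : 'I_n) : i = m :> nat -> i <= u i.
  elim: m i => [|m IH] i im; first by rewrite im.
  have lt_m : m < n by have := ltn_ord i; lia.
  have := inc (Ordinal lt_m) i im; have := IH (Ordinal lt_m) erefl => /=; lia.
have := leqif_sum (P := xpredT) (fun (i : 'I_n) _ => leqif_eq (le_u _ i erefl)).
case=> _; rewrite [X in _ == X](reindex_inj (@perm_inj _ u^-1%g)) /=.
under [X in _ == X]eq_bigr do rewrite permKV.
rewrite eqxx => /esym/forallP u_id; apply/permP=> i; rewrite perm1.
by apply/val_inj/eqP; rewrite eq_sym; apply: u_id.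
Qed.

(** Induction on the number of pairs inverted by [w] but not by [pi]. Unless [pi = w], some
    consecutive values of [pi] form such a pair, and exchanging them stays below [w]. *)
Lemma compatible_dreams_unique w pi : dreams w != set0 ->
    (forall a b, a < b -> pi^-1%g b < pi^-1%g a -> w^-1%g b < w^-1%g a) ->
  exists2 P, P \in compatible_dreams w pi &
    {in compatible_dreams w pi &, forall P1 P2, P1 = P2}.
Proof.
case/set0Pn=> P0 w0.
pose todo pi := [set x : 'I_n * 'I_n |
  [&& x.1 < x.2, pi^-1%g x.1 < pi^-1%g x.2 & w^-1%g x.2 < w^-1%g x.1]].
have [m] := ubnP #|todo pi|; elim: m pi => // m IH pi le_m pi_w.
have [->|pi_neq] := eqVneq pi w.
  have [P Pw] := compatible_dreams_self_exists w0.
  by exists P => // P1 P2; apply: compatible_dreams_self_uniq.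
have /existsP[i /existsP[j /andP[/eqP ij lt_ji]]] :
    [exists i : 'I_n, exists j : 'I_n, (j == i.+1 :> nat) && (w^-1%g (pi j) < w^-1%g (pi i))].
  (* If [w] kept the order of all consecutive values of [pi], then [pi * w^-1] would be
     increasing. *)
  apply: contraNT pi_neq => none; apply/eqP.
  have: (pi * w^-1)%g = 1%g; last by move/(congr1 (fun u => u * w)%g); rewrite mulgKV mul1g.
  apply: perm_increasing_eq1 => i j ij; rewrite !permM ltn_neqAle !(inj_eq val_inj, inj_eq perm_inj).
  rewrite -val_eqE /= ij ltn_eqF //= leqNgt; apply: contra none => lt_ji.
  by apply/existsP; exists i; apply/existsP; exists j; rewrite ij eqxx.
set a := pi i in lt_ji; set b := pi j in lt_ji.
have ab_adj : pi^-1%g b = (pi^-1%g a).+1 :> nat by rewrite !permK.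
have [adj adj'] := adjacent_from_tperm ab_adj.
have ab : a < b.
  rewrite ltnNge leq_eqVlt (inj_eq val_inj) negb_or.
  apply/andP; split; first by apply: contraTneq lt_ji => ->; rewrite ltnn.
  by apply/negP=> /pi_w; rewrite ab_adj ltnSn => /(_ isT); lia.
have aNb : a != b by rewrite -val_eqE neq_ltn ab.
set pi' := (pi * tperm a b)%g in adj adj'.
have pi'K : (pi' * tperm b a)%g = pi by rewrite -mulgA tpermC tperm2 mulg1.
have pi_ab : pi^-1%g a < pi^-1%g b by rewrite ab_adj.
have pi'_ba : pi'^-1%g b < pi'^-1%g a.
  by rewrite invMg tpermV !permM tpermL tpermR.
rewrite pi'K in adj'.
have pi'_w (x y : 'I_n) : x < y -> pi'^-1%g y < pi'^-1%g x -> w^-1%g y < w^-1%g x.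
  move=> xy yx; have [[-> ->] //|yx_ba] := eqVneq (y, x) (b, a).
  by apply: pi_w xy _; apply: adj'.
have [|P Ppi' uniq'] := IH pi' _ pi'_w.
  rewrite -ltnS; apply: leq_trans le_m; rewrite ltnS; apply: proper_card; apply/properP; split.
    apply/subsetP=> -[x y]; rewrite !inE /= => /and3P[xy yx ->]; rewrite xy andbT /=.
    by apply: adj' yx; apply: contraTneq xy => -[-> ->]; rewrite -leqNgt ltnW.
  exists (a, b); rewrite !inE /= ab ?pi_ab ?lt_ji //.
  by rewrite ltnNge (ltnW pi'_ba).
have inv_ab : (a < b) (+) (w^-1%g a < w^-1%g b) by rewrite ab ltnNge (ltnW lt_ji).
have inv_ba : (b < a) (+) (w^-1%g b < w^-1%g a) by rewrite lt_ji ltnNge (ltnW ab).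
have bNa : b != a by rewrite eq_sym.
(* Existence comes back from [pi'] to [pi] by the same exchange, with [a] and [b] in opposite
   roles. *)
have [Q Qpi] : exists Q, Q \in compatible_dreams w pi.
  have := compatible_step (P := P) (w := w) (pi := pi') bNa; rewrite /= pi'K.
  by case/(_ adj' inv_ba pi'_ba Ppi') => [|[c [d [_ _ _ _ [_ _]]]]] ?; [exists P | exists (flip P c d)].
exists Q => // P1 P2; exact: compatible_step_uniq aNb adj inv_ab pi_ab uniq'.
Qed.

End Sweep.

(** * The geometry of alternating shapes *)

Import Order.TTheory GRing.Theory Num.Theory.
Local Open Scope ring_scope.

(* South and east steps go from the diagonal x - y = k to the diagonal x - y = k + 1.
   A path made of such steps is encoded by the function mapping k to the abscissa of
   its vertex on the k-th diagonal. *)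
Definition diagonal_edge (f : nat -> int) (k : nat) : edge :=
  if f k.+1 == f k then vedge (f k, f k - k%:Z - 1) else hedge (f k, f k - k%:Z).

Definition SE_profile (n : nat) (f : nat -> int) :=
  forall k, (k < n)%N -> f k.+1 = f k \/ f k.+1 = f k + 1.

Definition profile (v : vertex) (st : seq step) (k : nat) : int := (walk v (take k st)).1.

Lemma walk_cat v s1 s2 : walk v (s1 ++ s2) = walk (walk v s1) s2.
Proof. exact: foldl_cat. Qed.

Lemma walk_take_S v st k : (k < size st)%N ->
  walk v (take k.+1 st) = move (walk v (take k st)) (nth South st k).
Proof. by move=> lt_k; rewrite (take_nth South) // /walk foldl_rcons. Qed.

Lemma nth_path_edges e0 v st k : (k < size st)%N ->
  nth e0 (path_edges v st) k = step_edge (walk v (take k st)) (nth South st k).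
Proof.
elim: st v k => [|d st IH] v [|k] //= lt_k; exact: IH.
Qed.

Lemma size_path_edges v st : size (path_edges v st) = size st.
Proof. by elim: st v => //= d st IH v; rewrite IH. Qed.

Section SEPath.
Variables (v : vertex) (st : seq step).
Hypotheses (v_diag : v.1 = v.2) (stSE : all south_or_east st).

Lemma SE_walk k : (k <= size st)%N ->
  walk v (take k st) = (profile v st k, profile v st k - k%:Z).
Proof.
rewrite /profile; elim: k => [_|k IH lt_k].
  by rewrite take0 /=; case: v v_diag => x y /= ->; congr pair; lia.
rewrite walk_take_S // IH 1?ltnW //.
have := all_nthP South stSE k lt_k; case: (nth _ _ _) => //= _; rewrite /east /south /=; congr pair; lia.
Qed.

Lemma SE_path_edge e0 k : (k < size st)%N ->
  nth e0 (path_edges v st) k = diagonal_edge (profile v st) k.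
Proof.
move=> lt_k; rewrite nth_path_edges // /diagonal_edge {1}/profile walk_take_S // SE_walk 1?ltnW //.
have := all_nthP South stSE k lt_k; case: (nth _ _ _) => //= _; rewrite /vedge /hedge /south /=.
  by case: eqP => //; lia.
by rewrite eqxx.
Qed.

Lemma SE_profileP : SE_profile (size st) (profile v st).
Proof.
move=> k lt_k; rewrite {1 3}/profile walk_take_S // SE_walk 1?ltnW //.
by have := all_nthP South stSE k lt_k; case: (nth _ _ _) => //= _; [right | left].
Qed.

Lemma SE_path_edges : path_edges v st = mkseq (diagonal_edge (profile v st)) (size st).
Proof.
apply: (@eq_from_nth _ (hedge (0, 0))); first by rewrite size_mkseq size_path_edges.
by move=> k; rewrite size_path_edges => lt_k; rewrite nth_mkseq // SE_path_edge.
Qed.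

End SEPath.

Lemma mem_SE_hedge n f x y : SE_profile n f ->
  (hedge (x, y) \in mkseq (diagonal_edge f) n) =
  [&& 0 <= x - y, x - y < n%:Z, f (absz (x - y)%R) == x & f (absz (x - y)%R).+1 == x + 1].
Proof.
move=> fP; apply/mapP/and4P => [[k]|[ge0 ltn /eqP fk /eqP fk1]].
  rewrite mem_iota /= add0n /diagonal_edge => lt_k; case: eqP => // ne [-> ->].
  have -> : f k - (f k - k%:Z) = k by lia.
  by have := fP k lt_k; split; rewrite ?absz_nat //; lia.
exists (absz (x - y)%R); first by rewrite mem_iota; lia.
by rewrite /diagonal_edge fk fk1; case: eqP => [|_]; [lia | rewrite /hedge; congr (_, (_, _)); lia].
Qed.

(** A south step along this edge starts from its upper end (x, y + 1), whence the diagonal x - y -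
    1. *)
Lemma mem_SE_vedge n f x y : SE_profile n f ->
  (vedge (x, y) \in mkseq (diagonal_edge f) n) =
  [&& 0 <= x - y - 1, x - y - 1 < n%:Z, f (absz (x - y - 1)%R) == x & f (absz (x - y - 1)%R).+1 == x].
Proof.
move=> fP; apply/mapP/and4P => [[k]|[ge0 ltn /eqP fk /eqP fk1]].
  rewrite mem_iota /= add0n /diagonal_edge => lt_k; case: eqP => // e [-> ->].
  have -> : f k - (f k - k%:Z - 1) - 1 = k by lia.
  by split; rewrite ?absz_nat ?e //; lia.
exists (absz (x - y - 1)%R); first by rewrite mem_iota; lia.
by rewrite /diagonal_edge fk fk1 eqxx /vedge; congr (_, (_, _)); lia.
Qed.

Lemma walk_NW_stair v t : walk v (NW_stair t) = (v.1 + t%:Z, v.2 + t%:Z).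
Proof.
elim: t v => [|t IH] [x y]; first by rewrite /= !addr0.
by rewrite (walk_cat _ [:: North; East]) -/(NW_stair t) IH /=; congr pair; lia.
Qed.

Lemma walk_SE_stair v t : walk v (SE_stair t) = (v.1 + t%:Z, v.2 + t%:Z).
Proof.
elim: t v => [|t IH] [x y]; first by rewrite /= !addr0.
by rewrite (walk_cat _ [:: East; North]) -/(SE_stair t) IH /=; congr pair; lia.
Qed.

(* The value of x - y is enough to tell the edges of the stairs, which run between the
   diagonals -1 and 0 and between n and n + 1, from those of the two other paths. *)
Lemma NW_stair_edge v t e : e \in path_edges v (NW_stair t) ->
  e.2.1 - e.2.2 = v.1 - v.2 - (~~ e.1)%:Z.
Proof.
elim: t v => [|t IH] [x y] //=; rewrite -[flatten _]/(NW_stair t) !inE.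
by case/or3P=> [/eqP ->|/eqP ->|/IH ->] /=; lia.
Qed.

Lemma SE_stair_edge v t e : e \in path_edges v (SE_stair t) ->
  e.2.1 - e.2.2 = v.1 - v.2 + e.1%:Z.
Proof.
elim: t v => [|t IH] [x y] //=; rewrite -[flatten _]/(SE_stair t) !inE.
by case/or3P=> [/eqP ->|/eqP ->|/IH ->] /=; lia.
Qed.

Section Shape.
Variables (n : nat) (F : alternating_shape n).
Hypothesis n_ge2 : (2 <= n)%N.

Definition lower_profile := profile (start_origin F) (start_steps F).
Definition upper_profile := profile (end_origin F) (end_steps F).
Local Notation s := lower_profile.
Local Notation e := upper_profile.

Lemma end_originE : end_origin F = ((NW_size F)%:Z, (NW_size F)%:Z).
Proof. by rewrite /end_origin walk_NW_stair /= !add0r. Qed.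

Lemma end_origin_diag : (end_origin F).1 = (end_origin F).2.
Proof. by rewrite end_originE. Qed.

Lemma lower_profileP : SE_profile n s.
Proof.
have := SE_profileP (v := start_origin F) erefl (start_steps_SE F).
by rewrite size_start_steps.
Qed.

Lemma upper_profileP : SE_profile n e.
Proof.
have := SE_profileP end_origin_diag (end_steps_SE F).
by rewrite size_end_steps.
Qed.

Lemma start_path_edges :
  path_edges (start_origin F) (start_steps F) = mkseq (diagonal_edge s) n.
Proof.
by rewrite (SE_path_edges (v := start_origin F) erefl (start_steps_SE F)) size_start_steps.
Qed.

Lemma end_path_edges :
  path_edges (end_origin F) (end_steps F) = mkseq (diagonal_edge e) n.
Proof. by rewrite (SE_path_edges end_origin_diag (end_steps_SE F)) size_end_steps. Qed.

Lemma start_walk k : (k <= n)%N ->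
  walk (start_origin F) (take k (start_steps F)) = (s k, s k - k%:Z).
Proof.
by move=> kn; rewrite (SE_walk (v := start_origin F) erefl (start_steps_SE F)) // size_start_steps.
Qed.

Lemma end_walk k : (k <= n)%N ->
  walk (end_origin F) (take k (end_steps F)) = (e k, e k - k%:Z).
Proof.
by move=> kn; rewrite (SE_walk end_origin_diag (end_steps_SE F)) // size_end_steps.
Qed.

Lemma start_endE : start_end F = (s n, s n - n%:Z).
Proof. by rewrite -start_walk // take_oversize ?size_start_steps. Qed.

Lemma lower_lt_upper k : (0 < k < n)%N -> s k < e k.
Proof. by move/(end_strictly_NE F) => /andP[]. Qed.

(** At the extremities the gap is the size of a stair, [NW_size] or [SE_size], possibly zero. *)
Lemma lower_le_upper k : (k <= n)%N -> s k <= e k.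
Proof.
move=> kn; have [k0|k_gt0] := posnP k.
  by subst k; rewrite /s /e /profile !take0 /= end_originE.
have [kn'|nk] := ltnP k n; first by rewrite ltW // lower_lt_upper ?k_gt0.
have -> : k = n by lia.
have := boundary_closed F; rewrite start_endE walk_SE_stair /=.
rewrite -[end_steps F](take_oversize (n := n)) ?size_end_steps // end_walk // => -[]; lia.
Qed.

Lemma boundary_edgeE ed :
    ed.2.1 - ed.2.2 != - (~~ ed.1)%:Z -> ed.2.1 - ed.2.2 != n%:Z + ed.1%:Z ->
  boundary_edge F ed
  = (ed \in mkseq (diagonal_edge s) n) || (ed \in mkseq (diagonal_edge e) n).
Proof.
move=> off_NW off_SE; rewrite boundaryE !mem_cat start_path_edges end_path_edges.
have -> : ed \in path_edges (start_origin F) (NW_stair (NW_size F)) = false.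
  by apply: contraNF off_NW => /NW_stair_edge /= ->; rewrite subrr add0r.
have -> : ed \in path_edges (start_end F) (SE_stair (SE_size F)) = false.
  apply: contraNF off_SE => /SE_stair_edge /= ->; rewrite start_endE /=; apply/eqP; lia.
by rewrite /= orbF.
Qed.

(* One goes from the cell northeast of the vertex (x, y) to the cell southwest of it
   by crossing two edges at (x, y), in two ways.  The way chosen on each diagonal is
   the one that avoids the stairs, and then meets a south-east path passing through
   (x, y) exactly once. *)
Lemma cell_jump x y : ((x, y) \in cells F) (+) ((x - 1, y - 1) \in cells F) =
  [&& 0 <= x - y, x - y <= n%:Z & (x == s (absz (x - y)%R)) (+) (x == e (absz (x - y)%R))].
Proof.
have viaSE : ((x, y) \in cells F) (+) ((x - 1, y - 1) \in cells F) =
    boundary_edge F (hedge (x, y)) (+) boundary_edge F (vedge (x, y - 1)).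
  by rewrite /= /south /west /=; do !case: (_ \in _).
have viaNW : ((x, y) \in cells F) (+) ((x - 1, y - 1) \in cells F) =
    boundary_edge F (vedge (x, y)) (+) boundary_edge F (hedge (x - 1, y)).
  by rewrite /= /south /west /=; do !case: (_ \in _).
have sP := lower_profileP; have eP := upper_profileP.
have [lt0|ge0] := ltP (x - y) 0.
  rewrite viaNW !boundary_edgeE /=; try lia.
  by rewrite !mem_SE_vedge // !mem_SE_hedge //; lia.
have [gtn|len] := ltP n%:Z (x - y).
  rewrite viaSE !boundary_edgeE /=; try lia.
  by rewrite !mem_SE_vedge // !mem_SE_hedge //; lia.
have [ltn|gen] := ltP (x - y) n%:Z.
  rewrite viaSE !boundary_edgeE /=; try lia.
  rewrite !mem_SE_vedge // !mem_SE_hedge //.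
  have -> : x - (y - 1) - 1 = x - y by lia.
  set k := absz (x - y)%R; have kn : (k < n)%N by lia.
  (* Paths that share the vertex (x, y) leave it by different edges, so the two crossings cancel.
     This can only occur for [k = 0], and then [n_ge2] makes the next diagonal interior. *)
  have lt_next : s k = e k -> s k.+1 < e k.+1.
    have [k0|k_gt0] := posnP k; first by move=> _; apply: lower_lt_upper; lia.
    by have := @lower_lt_upper k; rewrite k_gt0 kn => /(_ isT); lia.
  have jump f : SE_profile n f ->
      ((f k == x) && (f k.+1 == x + 1) = (f k == x) && (f k.+1 == f k + 1)) /\
      ((f k == x) && (f k.+1 == x) = (f k == x) && ~~ (f k.+1 == f k + 1)).
    by move=> /(_ k kn) fk; split; case: eqP => //= <-; lia.
  rewrite !ge0 ltn /= !(jump _ sP).1 !(jump _ sP).2 !(jump _ eP).1 !(jump _ eP).2.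
  rewrite ![x == _]eq_sym; case: (s k =P x) => sx; case: (e k =P x) => ex /=;
    rewrite ?orbF //; try by case: eqP.
  have := lt_next (etrans sx (esym ex)); have := sP k kn; have := eP k kn.
  have : s k = e k :> int by rewrite sx ex.
  clear; clearbody k; do 2!case: eqP => //=; lia.
have xyn : x - y = n%:Z by lia.
rewrite viaNW !boundary_edgeE /=; try lia.
rewrite !mem_SE_vedge // !mem_SE_hedge // xyn.
have -> : x - 1 - y = n.-1%:Z by lia.
have -> : n%:Z - 1 = n.-1%:Z by lia.
rewrite !absz_nat prednK; last by lia.
have n1 : (n.-1 < n)%N by lia.
have lt_prev : s n.-1 < e n.-1 by apply: lower_lt_upper; lia.
have jump f : SE_profile n f ->
    ((f n.-1 == x - 1) && (f n == x) = (f n == x) && (f n == f n.-1 + 1)) /\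
    ((f n.-1 == x) && (f n == x) = (f n == x) && ~~ (f n == f n.-1 + 1)).
  move=> /(_ _ n1); rewrite prednK; last by lia.
  by move=> fn; split; rewrite andbC; case: eqP => //= <-; lia.
have -> : (n.-1%:Z < n%:Z) = true by lia.
rewrite subrK ?lexx /= !(jump _ sP).1 !(jump _ sP).2 !(jump _ eP).1 !(jump _ eP).2.
have := sP _ n1; have := eP _ n1; rewrite prednK => [en sn|]; last by lia.
rewrite ![x == _]eq_sym; case: (s n =P x) => sx; case: (e n =P x) => ex /=;
  rewrite ?orbF //; try by case: eqP.
have : s n = e n :> int by rewrite sx ex.
by move: sn en lt_prev; clear; do 2!case: eqP => //=; lia.
Qed.

(** Along a diagonal, [cell_jump] makes membership change exactly at the two profiles. The induction
    starts far to the southwest, where finiteness leaves no cell. *)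
Lemma mem_cells_diagonal d x : ((x, x - d) \in cells F) =
  [&& 0 <= d, d <= n%:Z, s (absz d) <= x & x < e (absz d)].
Proof.
have [M Ms below] : exists2 M : int, M <= s (absz d) & forall z, z \in cells F -> M <= z.1.
  exists (- (\sum_(z : cells F) absz (val z).1 + absz (s (absz d)))%N%:Z) => [|z zF]; first by lia.
  rewrite (bigD1 [` zF]%fset) //=; lia.
have [m] : exists m : nat, x < M + m%:Z by exists (absz (x - M)%R).+1; lia.
elim: m x => [|m IH] x lt_x.
  have -> : (x, x - d) \in cells F = false by apply/negP => /below /=; lia.
  by apply/esym/and4P => -[_ _]; lia.
have := cell_jump x (x - d); have -> : x - (x - d) = d by lia.
have -> : x - d - 1 = (x - 1) - d by lia.
rewrite (IH (x - 1)); last by lia.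
have [d_ge0|] := boolP (0 <= d); last by rewrite /= addbF.
have [d_le|] := boolP (d <= n%:Z); last by rewrite /= addbF.
have dn : (absz d <= n)%N by lia.
have := lower_le_upper dn; move: (s _) (e _) => a b ab.
by move/(canRL (addbK _)) => ->; lia.
Qed.

Lemma mem_cells c : (c \in cells F) = let k := absz (c.1 - c.2)%R in
  [&& 0 <= c.1 - c.2, c.1 - c.2 <= n%:Z, s k <= c.1 & c.1 < e k].
Proof.
by case: c => x y /=; have := mem_cells_diagonal (x - y) x; rewrite subKr.
Qed.

(** * Sweeping an alternating shape *)

(* The absolute value is harmless: x - y is nonnegative on [F], by [mem_cells]. *)
Definition diagonal (c : cells F) : nat := absz ((val c).1 - (val c).2)%R.
Definition level (c : cells F) : int := (val c).1 + (val c).2.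
(** Sorting by x + y puts the west and south neighbours of a cell before it; cells of equal level
    share no side, so ties may be broken arbitrarily. *)
Definition sweep : seq (cells F) := sort (relpre level <=%R) (enum {: cells F}).

Lemma cellsP (c : cells F) : [/\ val c = ((val c).1, (val c).1 - (diagonal c)%:Z),
  (diagonal c <= n)%N, s (diagonal c) <= (val c).1, (val c).1 < e (diagonal c)
  & level c = (val c).1 + (val c).1 - (diagonal c)%:Z].
Proof.
have := valP c; rewrite /level mem_cells /diagonal /=.
case: (val c) => x y /= /and4P[h1 h2 h3 h4]; split=> //; rewrite ?gez0_abs //; try lia.
by congr pair; lia.
Qed.

Lemma cell_at k x : (k <= n)%N -> s k <= x -> x < e k ->
  exists2 c : cells F, val c = (x, x - k%:Z) & diagonal c = k.
Proof.
move=> kn sx xe; have xF : (x, x - k%:Z) \in cells F.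
  by rewrite mem_cells_diagonal absz_nat sx xe; lia.
by exists [` xF]%fset => //; rewrite /diagonal /=; lia.
Qed.

Lemma cells_eq (c d : cells F) : diagonal c = diagonal d -> (val c).1 = (val d).1 -> c = d.
Proof.
move=> kcd xcd; apply: val_inj; have [-> _ _ _ _] := cellsP c; have [-> _ _ _ _] := cellsP d.
by rewrite kcd xcd.
Qed.

Lemma sweep_uniq : uniq sweep.
Proof. by rewrite sort_uniq enum_uniq. Qed.

Lemma mem_sweep c : c \in sweep.
Proof. by rewrite mem_sort mem_enum. Qed.

Lemma sweep_split l c l' d : sweep = l ++ c :: l' ->
  (level d < level c -> d \in l) /\ (level c < level d -> d \notin l).
Proof.
have tr : transitive (relpre level <=%R) by move=> y x z; apply: le_trans.
have tot : total (relpre level <=%R) by move=> x y; apply: le_total.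
move=> E; have := sort_sorted tot (enum {: cells F}).
rewrite -/sweep (sorted_pairwise tr) E pairwise_cat /= => /and3P[/allrelP lc _ /andP[/allP cl _]].
have := mem_sweep d; rewrite E mem_cat inE; split=> cd.
  case/or3P: H => // [/eqP dc|/cl /=]; first by rewrite dc ltxx in cd.
  by rewrite leNgt cd.
by apply/negP=> dl; have := lc d c dl (mem_head _ _); rewrite /= leNgt cd.
Qed.

(** A profile in the sense of [diagonal_edge]: each cell swept on the [k]-th diagonal pushes the
    vertex there one unit northeast. *)
Definition frontier (l : seq (cells F)) (k : nat) : int :=
  s k + (count (fun c => diagonal c == k) l)%:Z.

Lemma frontier_rcons l c k :
  frontier (rcons l c) k = frontier l k + (diagonal c == k)%:Z.
Proof. by rewrite /frontier -cats1 count_cat /= addn0; lia. Qed.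

Definition swept (l : seq (cells F)) :=
  (forall k, (k <= n)%N -> frontier l k <= e k) /\
  (forall c, (c \in l) = ((val c).1 < frontier l (diagonal c))).

(** The frontier runs along the west and south sides of the next cell. A smaller abscissa would
    leave a cell of lower level unswept ([lo]), a larger one would mean that a cell of higher level
    is already swept ([hi]). *)
Lemma frontier_at l c l' : sweep = l ++ c :: l' -> swept l ->
  [/\ frontier l (diagonal c) = (val c).1,
      (0 < diagonal c)%N -> frontier l (diagonal c).-1 = (val c).1 &
      (diagonal c < n)%N -> frontier l (diagonal c).+1 = (val c).1 + 1].
Proof.
move=> E [le_e memE]; have [_ kn sx xe levc] := cellsP c.
have s_le k : s k <= frontier l k by rewrite /frontier; lia.
have lo k x : (k <= n)%N -> x <= e k -> x + x - 2 - k%:Z < level c -> x <= frontier l k.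
  move=> kn' xe' lev; rewrite leNgt; apply/negP=> lt_fx.
  have [d vd kd] := cell_at kn' (s_le k) (lt_le_trans lt_fx xe').
  have dc : level d < level c by rewrite {1}/level vd /=; lia.
  by have := (sweep_split d E).1 dc; rewrite memE vd kd ltxx.
have hi k x : (k <= n)%N -> s k <= x -> level c < x + x - k%:Z -> frontier l k <= x.
  move=> kn' sx' lev; rewrite leNgt; apply/negP=> lt_xf.
  have [d vd kd] := cell_at kn' sx' (lt_le_trans lt_xf (le_e k kn')).
  have cd : level c < level d by rewrite {2}/level vd /=; lia.
  by have := (sweep_split d E).2 cd; rewrite memE vd kd /= lt_xf.
have cNl : c \notin l.
  by move: sweep_uniq; rewrite E cat_uniq /= negb_or => /and3P[_ /andP[]].
set k := diagonal c in kn sx xe levc *; set x := (val c).1 in sx xe levc *.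
split.
- apply/eqP; rewrite eq_le lo //; try lia.
  by move: cNl; rewrite memE -/k -/x -leNgt => ->.
- move=> k0; have k1 : (k.-1 < n)%N by lia.
  have := lower_profileP k1; have := upper_profileP k1; rewrite prednK // => he hs.
  by apply/eqP; rewrite eq_le lo ?hi //; lia.
- move=> k1; have := lower_profileP k1; have := upper_profileP k1 => he hs.
  by apply/eqP; rewrite eq_le lo ?hi //; lia.
Qed.

Lemma sweptP l l' : sweep = l ++ l' -> swept l.
Proof.
elim/last_ind: l l' => [|l c IH] l' E.
  split=> [k kn|c]; rewrite /frontier /= addr0; first exact: lower_le_upper.
  by have [_ _ sx _ _] := cellsP c; rewrite in_nil ltNge sx.
rewrite cat_rcons in E; have sw := IH _ E; have [fc _ _] := frontier_at E sw.
have [le_e memE] := sw; have [_ _ _ xe _] := cellsP c.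
split=> [k kn|d]; rewrite frontier_rcons.
  by have [<-|_] := eqVneq; [rewrite fc; lia | rewrite addr0 le_e].
rewrite mem_rcons inE memE; have [cd|cd] := eqVneq (diagonal c) (diagonal d).
  rewrite -cd fc; have [->|dc] := eqVneq d c; first by rewrite /=; lia.
  have : (val d).1 != (val c).1 by apply: contraNneq dc => /cells_eq ->.
  rewrite /=; lia.
by rewrite addr0; case: eqVneq => // dc; rewrite dc eqxx in cd.
Qed.

(** This and the next lemmas describe one step: the west and south sides of the cell, at two
    neighbouring positions, are replaced by its north and east sides. *)
Lemma edge_W l c l' : sweep = l ++ c :: l' -> (0 < diagonal c)%N ->
  diagonal_edge (frontier l) (diagonal c).-1 = side_W (val c).
Proof.
move=> E k0; have [fk /(_ k0) fk1 _] := frontier_at E (sweptP E).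
have [-> _ _ _ _] := cellsP c; rewrite /diagonal_edge prednK // fk fk1 eqxx.
rewrite /side_W /vedge; congr (_, (_, _)); lia.
Qed.

Lemma edge_S l c l' : sweep = l ++ c :: l' -> (diagonal c < n)%N ->
  diagonal_edge (frontier l) (diagonal c) = side_S (val c).
Proof.
move=> E kn; have [fk _ /(_ kn) fk1] := frontier_at E (sweptP E).
have [-> _ _ _ _] := cellsP c; rewrite /diagonal_edge fk fk1.
by case: eqP => [|_] //; lia.
Qed.

Lemma edge_N l c l' : sweep = l ++ c :: l' -> (0 < diagonal c)%N ->
  diagonal_edge (frontier (rcons l c)) (diagonal c).-1 = side_N (val c).
Proof.
move=> E k0; have [fk /(_ k0) fk1 _] := frontier_at E (sweptP E).
have [-> _ _ _ _] := cellsP c; rewrite /diagonal_edge prednK // !frontier_rcons fk fk1 eqxx.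
have -> : (diagonal c == (diagonal c).-1) = false by lia.
case: eqP => [|_] /=; first by lia.
rewrite /side_N /hedge /north; congr (_, (_, _)) => /=; lia.
Qed.

Lemma edge_E l c l' : sweep = l ++ c :: l' -> (diagonal c < n)%N ->
  diagonal_edge (frontier (rcons l c)) (diagonal c) = side_E (val c).
Proof.
move=> E kn; have [fk _ /(_ kn) fk1] := frontier_at E (sweptP E).
have [-> _ _ _ _] := cellsP c; rewrite /diagonal_edge !frontier_rcons fk fk1 eqxx.
have -> : (diagonal c == (diagonal c).+1) = false by lia.
case: eqP => [_|] /=; last by lia.
rewrite /side_E /vedge /east; congr (_, (_, _)) => /=; lia.
Qed.

Lemma edge_other l c k : diagonal c != k -> diagonal c != k.+1 ->
  diagonal_edge (frontier (rcons l c)) k = diagonal_edge (frontier l) k.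
Proof.
by move=> /negbTE ck /negbTE ck1; rewrite /diagonal_edge !frontier_rcons ck ck1 !addr0.
Qed.

Lemma edge_end k : (k < n)%N -> diagonal_edge (frontier sweep) k = diagonal_edge e k.
Proof.
have [le_e memE] := sweptP (esym (cats0 sweep)).
have fe j : (j <= n)%N -> frontier sweep j = e j.
  move=> jn; apply/eqP; rewrite eq_le le_e // leNgt; apply/negP=> lt_e.
  have s_le : s j <= frontier sweep j by rewrite /frontier; lia.
  have [c vc kc] := cell_at jn s_le lt_e.
  by have := mem_sweep c; rewrite memE vc kc /= ltxx.
by move=> kn; rewrite /diagonal_edge !fe // ltnW.
Qed.

(** * Pipes as labels of frontier edges *)

Implicit Types (P : filling F) (c : cells F) (l : seq (cells F)).

(** Attaches pipes to edges instead of strands, so that they can be read on the frontier. The first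
    case is needed since no strand leaves through a start edge. *)
Definition passes P (a : 'I_n) ed := (ed == start_edge F a) || exits_through P a ed.

Lemma in_pipeE P a st : in_pipe P a st = passes P a (strand_in st).
Proof.
apply/existsP/orP => [[st0 /andP[/eqP st0E /connectP[p]]]|[/eqP stE|/existsP[st1]]].
- case/lastP: p => [|p st'] /=; first by move=> _ ->; left; rewrite st0E.
  rewrite rcons_path last_rcons => /andP[path_p next] ->; right.
  apply/existsP; exists (last st0 p); apply/andP; split; last exact: next.
  by apply/existsP; exists st0; rewrite st0E eqxx; apply/connectP; exists p.
- by exists st; rewrite stE eqxx connect0.
case/andP=> /existsP[st0 /andP[st0E con]] next; exists st0; rewrite st0E /=.
exact: connect_trans con (@connect1 _ (strand_next P) st1 st next).
Qed.

Lemma exits_E P a c : exits_through P a (side_E (val c)) = in_pipe P a (c, c \in P).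
Proof.
apply/existsP/idP => [[[d b]] /andP[ad]|ac]; last first.
  by exists (c, c \in P); rewrite ac /strand_out eqxx /=.
rewrite /strand_out /=; case: ifP => // bd.
case/eqP; case vd : (val d) => [xd yd]; case vc : (val c) => [xc yc] /= [x y].
have cd : c = d by apply: val_inj; rewrite vd vc; congr pair; lia.
by subst d; rewrite -(eqP bd).
Qed.

Lemma exits_N P a c : exits_through P a (side_N (val c)) = in_pipe P a (c, c \notin P).
Proof.
apply/existsP/idP => [[[d b]] /andP[ad]|ac]; last first.
  by exists (c, c \notin P); rewrite ac /strand_out /=; case: (c \in P).
rewrite /strand_out /=; case: ifP => // bd.
case/eqP; case vd : (val d) => [xd yd]; case vc : (val c) => [xc yc] /= [x y].
have cd : c = d by apply: val_inj; rewrite vd vc; congr pair; lia.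
by subst d; move: ad bd; case: b; case: (c \in P).
Qed.

Lemma exits_side P a ed : exits_through P a ed ->
  exists c : cells F, ed = side_E (val c) \/ ed = side_N (val c).
Proof.
case/existsP=> -[c b] /andP[_ /eqP <-]; exists c.
by rewrite /strand_out; case: ifP; [left | right].
Qed.

Lemma start_edgeE (k : 'I_n) : start_edge F k = diagonal_edge s k.
Proof. by rewrite /start_edge start_path_edges nth_mkseq. Qed.

Lemma end_edgeE (k : 'I_n) : end_edge F k = diagonal_edge e k.
Proof. by rewrite /end_edge end_path_edges nth_mkseq. Qed.

Lemma diagonal_edge_diag f k :
  (diagonal_edge f k).2.1 - (diagonal_edge f k).2.2 = k%:Z + (diagonal_edge f k).1%:Z.
Proof. by rewrite /diagonal_edge; case: ifP => _ /=; lia. Qed.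

Lemma diagonal_edge_inj f g k : SE_profile n f -> SE_profile n g -> (k < n)%N ->
  diagonal_edge f k = diagonal_edge g k -> f k = g k /\ f k.+1 = g k.+1.
Proof.
rewrite /diagonal_edge => fP gP kn.
have [f0|f1] := f k.+1 =P f k; have [g0|g1] := g k.+1 =P g k => // -[fg _].
  by rewrite f0 g0.
case: (fP k kn) f1 => // -> _; case: (gP k kn) g1 => // -> _.
by rewrite fg.
Qed.

Lemma start_edge_inj : injective (start_edge F).
Proof.
move=> i j; rewrite !start_edgeE => ij; apply: val_inj => /=.
by have := diagonal_edge_diag s j; rewrite -ij diagonal_edge_diag; lia.
Qed.

Lemma start_not_E k c : side_E (val c) != start_edge F k.
Proof.
rewrite start_edgeE /diagonal_edge; have [vc kn sx _ _] := cellsP c; rewrite vc.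
have [fk|//] := s k.+1 =P s k; apply/negP => /eqP[x1 y1].
have dk : diagonal c = k by lia.
by move: sx; rewrite dk -x1 gerDl.
Qed.

Lemma start_not_N k c : side_N (val c) != start_edge F k.
Proof.
rewrite start_edgeE /diagonal_edge; have [vc kn sx _ _] := cellsP c; rewrite vc.
have [//|fk] := s k.+1 =P s k; apply/negP => /eqP[x1 y1].
have dk : diagonal c = k.+1 by lia.
case: (lower_profileP (ltn_ord k)) => // fk1.
by move: sx; rewrite dk fk1 -x1 gerDl.
Qed.

Lemma passes_W P a c : passes P a (side_W (val c)) = in_pipe P a (c, true).
Proof. by rewrite in_pipeE. Qed.

Lemma passes_S P a c : passes P a (side_S (val c)) = in_pipe P a (c, false).
Proof. by rewrite in_pipeE. Qed.

Lemma passes_E P a c : passes P a (side_E (val c)) =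
  passes P a (if c \in P then side_W (val c) else side_S (val c)).
Proof. by rewrite {1}/passes (negbTE (start_not_E a c)) exits_E in_pipeE /strand_in /=. Qed.

Lemma passes_N P a c : passes P a (side_N (val c)) =
  passes P a (if c \in P then side_S (val c) else side_W (val c)).
Proof.
by rewrite {1}/passes (negbTE (start_not_N a c)) exits_N in_pipeE /strand_in /=; case: (c \in P).
Qed.

(** A strand leaving through this edge would lie in a cell on the diagonal -1, and vertical start
    edges have x - y positive. *)
Lemma passes_NW_stair P a c : diagonal c = 0%N -> passes P a (side_W (val c)) = false.
Proof.
move=> c0; apply/negP=> /orP[/eqP|/exits_side[d []]].
- rewrite start_edgeE => eW; have := diagonal_edge_diag s a; rewrite -eW.
  by have [-> _ _ _ _] := cellsP c; rewrite /= c0; lia.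
- have [-> _ _ _ _] := cellsP c; have [-> _ _ _ _] := cellsP d.
  by rewrite c0 => -[]; lia.
by [].
Qed.

Lemma passes_SE_stair P a c : diagonal c = n -> passes P a (side_S (val c)) = false.
Proof.
move=> cn; apply/negP=> /orP[/eqP|/exits_side[d []]] //.
- rewrite start_edgeE => eS; have := diagonal_edge_diag s a; rewrite -eS.
  by have [-> _ _ _ _] := cellsP c; rewrite /= cn; have := ltn_ord a; lia.
- have [-> _ _ _ _] := cellsP c; have [-> dn _ _ _] := cellsP d.
  by rewrite cn => -[]; lia.
Qed.

(* Once a cross on the diagonal 0 or n has sent a pipe into a stair, some frontier edge
   carries no pipe, whatever the cells swept later. *)
Definition full P l := forall k : 'I_n, exists a, passes P a (diagonal_edge (frontier l) k).

Definition interior c := (0 < diagonal c < n)%N.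

(** Read backwards: the pipes on the north and east sides come from the south and west sides. A
    cross on the diagonal 0 or n would draw one of them from a stair edge, which carries none. *)
Lemma full_rcons P l c l' : sweep = l ++ c :: l' -> full P (rcons l c) ->
  full P l /\ (c \in P -> interior c).
Proof.
move=> E ful; have [_ kn _ _ _] := cellsP c.
have N (k0 : (0 < diagonal c)%N) :
    exists a, passes P a (if c \in P then side_S (val c) else side_W (val c)).
  have k1 : ((diagonal c).-1 < n)%N by move: k0; lia.
  have [a] := ful (Ordinal k1); rewrite /= (edge_N E k0) passes_N => pa; by exists a.
have S (k1 : (diagonal c < n)%N) :
    exists a, passes P a (if c \in P then side_W (val c) else side_S (val c)).
  have [a] := ful (Ordinal k1); rewrite /= (edge_E E k1) passes_E => pa; by exists a.
have int : c \in P -> interior c.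
  move=> cP; rewrite cP in N S; apply/andP; split.
    rewrite lt0n; apply/negP=> /eqP c0; have [|a] := S; first by lia.
    by rewrite passes_NW_stair.
  rewrite ltn_neqAle kn andbT; apply/negP=> /eqP cn; have [|a] := N; first by lia.
  by rewrite passes_SE_stair.
split=> // k; have [ck|ck] := eqVneq (diagonal c) k.
  have k1 : (diagonal c < n)%N by rewrite ck.
  rewrite -ck (edge_S E k1); case: (c \in P) N S int => N S int; last exact: S.
  by apply: N; case/andP: (int isT).
have [ck1|ck1] := eqVneq (diagonal c) k.+1.
  have k0 : (0 < diagonal c)%N by rewrite ck1.
  have -> : k = (diagonal c).-1 :> nat by rewrite ck1.
  rewrite (edge_W E k0); case: (c \in P) N S int => N S int; last exact: N.
  by apply: S; case/andP: (int isT).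
by have [a] := ful k; rewrite edge_other // => pa; exists a.
Qed.

Lemma exit_perm_interior P w c : has_exit_perm P w -> c \in P -> interior c.
Proof.
move=> /forallP ex; have ful : full P sweep.
  move=> k; exists (w k); rewrite edge_end // -end_edgeE /passes ex orbT //.
have all_full l l' : sweep = l ++ l' -> full P l.
  elim: l' l => [|d l' IH] l E; first by rewrite -[l]cats0 -E.
  have ful_d : full P (rcons l d) by apply: IH; rewrite cat_rcons.
  exact: (full_rcons E ful_d).1.
have [l [l' E]] := mem_split (mem_sweep c).
have ful_c : full P (rcons l c) by apply: (all_full _ l'); rewrite cat_rcons.
exact: (full_rcons E ful_c).2.
Qed.

(** Out of range, the default is position 0. With the truncated predecessor on the diagonal 0, this
    only yields arbitrary values at cells that are not interior. *)
Definition position (k : nat) : 'I_n := insubd (Ordinal (ltnW n_ge2)) k.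
Definition left_position c := position (diagonal c).-1.
Definition right_position c := position (diagonal c).
Local Notation state := (state left_position right_position).
Local Notation upper := (upper sweep left_position right_position).
Local Notation lower := (lower sweep left_position right_position).

Lemma positionE k : (k < n)%N -> position k = k :> nat.
Proof. by move=> kn; rewrite val_insubd kn. Qed.

Lemma positions_adjacent c : interior c -> right_position c = (left_position c).+1 :> nat.
Proof. by case/andP=> c0 cn; rewrite !positionE ?prednK //; lia. Qed.

(** The bridge between geometry and permutations: at each cell, labels of frontier edges and states
    obey the same update. *)
Lemma state_passes P l l' k a : legal interior P -> sweep = l ++ l' ->
  passes P a (diagonal_edge (frontier l) (nat_of_ord k)) = (state P l k == a).
Proof.
move=> /subsetP legP; elim/last_ind: l l' k => [|l c IH] l' k E.
  have -> : diagonal_edge (frontier ([::] : seq (cells F))) k = start_edge F k.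
    have f0 j : frontier ([::] : seq (cells F)) j = s j by rewrite /frontier /= addr0.
    by rewrite start_edgeE /diagonal_edge !f0.
  have -> : passes P a (start_edge F k) = (start_edge F k == start_edge F a).
    rewrite /passes; case exk : (exits_through _ _ _); last by rewrite orbF.
    by have [c [/esym/eqP|/esym/eqP]] := exits_side exk;
      rewrite (negbTE (start_not_E _ _), negbTE (start_not_N _ _)).
  by rewrite perm1 (inj_eq start_edge_inj).
rewrite cat_rcons in E; rewrite state_rcons /cell_step.
have [ck|ck] := eqVneq (diagonal c) k.
  have k1 : (diagonal c < n)%N by rewrite ck.
  rewrite -ck (edge_E E k1) passes_E; case: ifP => cP.
    have /andP[c0 _] := legP _ cP.
    have kq : k = right_position c by apply: val_inj; rewrite /= positionE.
    have c1 : ((diagonal c).-1 < n)%N by lia.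
    by rewrite permM kq tpermR -(IH _ _ E) positionE ?(edge_W E).
  by rewrite -(edge_S E k1) ck (IH _ _ E).
have [ck1|ck1] := eqVneq (diagonal c) k.+1.
  have c0 : (0 < diagonal c)%N by rewrite ck1.
  have -> : diagonal_edge (frontier (rcons l c)) k = side_N (val c).
    by rewrite -(edge_N E c0) ck1.
  rewrite passes_N; case: ifP => cP.
    have /andP[_ cn] := legP _ cP.
    have c1 : ((diagonal c).-1 < n)%N by lia.
    have kp : k = left_position c by apply: val_inj; rewrite /= positionE // ck1.
    by rewrite permM kp tpermL -(IH _ _ E) positionE // (edge_S E).
  by rewrite -(edge_W E c0) ck1 (IH _ _ E).
rewrite edge_other // (IH _ _ E); case: ifP => // cP.
have /andP[c0 cn] := legP _ cP.
rewrite permM tpermD // -val_eqE /= positionE //; lia.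
Qed.

Lemma in_pipe_upper P c a : legal interior P -> interior c ->
  in_pipe P a (c, true) = (upper P c == a).
Proof.
move=> legP /andP[c0 cn]; have [l [l' E]] := mem_split (mem_sweep c).
rewrite /upper (state_at_split _ _ sweep_uniq P E) -(state_passes _ _ legP E).
by rewrite positionE ?(edge_W E) ?passes_W //; lia.
Qed.

Lemma in_pipe_lower P c a : legal interior P -> interior c ->
  in_pipe P a (c, false) = (lower P c == a).
Proof.
move=> legP /andP[c0 cn]; have [l [l' E]] := mem_split (mem_sweep c).
rewrite /lower (state_at_split _ _ sweep_uniq P E) -(state_passes _ _ legP E).
by rewrite positionE ?(edge_S E) ?passes_S.
Qed.

Lemma has_exit_permE P w : legal interior P ->
  has_exit_perm P w = (state P sweep == w).
Proof.
move=> legP.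
have exE k a : exits_through P a (end_edge F k) = (state P sweep k == a).
  rewrite -(state_passes _ _ legP (esym (cats0 _))) edge_end // -end_edgeE /passes.
  (* An end edge is never a start edge: the profiles would agree on two consecutive diagonals, one
     of which is interior as [2 <= n]. *)
  case: eqP => // eq_edge; exfalso; rewrite end_edgeE start_edgeE in eq_edge.
  have ka : k = a :> nat.
    have := diagonal_edge_diag s a; rewrite -eq_edge diagonal_edge_diag; lia.
  rewrite -ka in eq_edge.
  have [ek ek1] := diagonal_edge_inj upper_profileP lower_profileP (ltn_ord k) eq_edge.
  have [k0|k0] := posnP k.
    have k1 : (0 < k.+1 < n)%N by lia.
    by have := lower_lt_upper k1; rewrite ek1 ltxx.
  by have := @lower_lt_upper k; rewrite k0 ltn_ord ek ltxx => /(_ isT).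
apply/forallP/eqP => [ex|<- k]; last by rewrite exE.
by apply/permP=> k; apply/eqP; rewrite -exE.
Qed.

Lemma reduced_pipe_dreamsE w :
  reduced_pipe_dreams F w = dreams sweep interior left_position right_position w.
Proof.
apply/setP=> P; rewrite !inE; case legP : (legal interior P); last first.
  apply/negP=> /andP[ex _]; move/negP: legP; apply; apply/subsetP => c.
  exact: exit_perm_interior ex.
rewrite has_exit_permE //; congr (_ && _).
have crossE a b : #|[set c | cross_at P a b c]| =
    count (crosses sweep left_position right_position P (a, b)) sweep.
  rewrite -size_filter -(card_uniqP (filter_uniq _ sweep_uniq)).
  apply: eq_card => c; rewrite inE mem_filter mem_sweep andbT /cross_at /crosses.
  case cP : (c \in P) => //=; have ic := subsetP legP c cP.
  by rewrite !in_pipe_upper // !in_pipe_lower // meetsE !inE !xpair_eqE.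
apply/forallP/forallP => [red [a b]|red a].
  have [<-|ab] := eqVneq a b; last by have /forallP/(_ b) := red a; rewrite ab crossE.
  rewrite (eq_count (a2 := pred0)) ?count_pred0 // => c.
  by rewrite (crosses_diag sweep_uniq positions_adjacent a c legP).
by apply/forallP=> b; apply/implyP=> _; rewrite crossE.
Qed.

(** A contact on the diagonal 0 or n has an elbow without a pipe, so it gives no arc. *)
Lemma contact_graphP P a b : legal interior P ->
  reflect (exists c, [/\ interior c, c \notin P, upper P c = a & lower P c = b])
          (contact_graph P a b).
Proof.
move=> legP; apply: (iffP existsP) => [[c /and3P[cP ac bc]]|[c [ic cP uc lc]]].
  have ic : interior c.
    have [_ cn _ _ _] := cellsP c; apply/andP; split.
      rewrite lt0n; apply: contraTN ac => /eqP c0.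
      by rewrite -passes_W passes_NW_stair.
    rewrite ltn_neqAle cn andbT; apply: contraTN bc => /eqP cn'.
    by rewrite -passes_S passes_SE_stair.
  by exists c; split=> //; apply/eqP; rewrite -?in_pipe_upper -?in_pipe_lower.
by exists c; rewrite cP in_pipe_upper // in_pipe_lower // uc lc !eqxx.
Qed.

End Shape.

(** * Linear extensions *)

(** Sorting by the number [h] of ancestors works, since acyclicity makes [h] increase strictly along
    arcs. *)
Lemma acyclic_linear_extension n (r : rel 'I_n) : acyclic r ->
  exists pi : 'S_n, forall a b, r a b -> ((pi^-1)%g a < (pi^-1)%g b)%N.
Proof.
move=> /forallP acyc; pose h a := #|[set x | connect r x a]|.
have lt_h a b : r a b -> (h a < h b)%N.
  move=> ab; apply/proper_card/properP; split.
    by apply/subsetP=> x; rewrite !inE => xa; apply: connect_trans xa (connect1 ab).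
  exists b; rewrite !inE ?connect0 //.
  by have /forallP/(_ b)/implyP := acyc a; apply.
pose le_h := relpre h leq; pose sorted_enum := sort le_h (enum 'I_n).
have mem_sorted a : a \in sorted_enum by rewrite mem_sort mem_enum.
have index_lt a : (index a sorted_enum < n)%N.
  by rewrite -[X in (_ < X)%N]size_enum_ord -(size_sort le_h) index_mem.
have rank_inj : injective (fun a => Ordinal (index_lt a)).
  by move=> a b /(congr1 val) /= /index_inj; apply.
exists (perm rank_inj)^-1%g => a b ab; rewrite invgK !permE /=.
rewrite ltnNge; apply/negP => le_ba.
have tr : transitive le_h by move=> y x z; apply: leq_trans.
have tot : total le_h by move=> x y; apply: leq_total.
have := sorted_leq_index tr (fun x => leqnn _) (sort_sorted tot (enum 'I_n)).
move=> /(_ b a (mem_sorted b) (mem_sorted a) le_ba); rewrite /= leqNgt => /negP; apply.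
exact: lt_h.
Qed.

Section LinearExtensions.
Variables (n : nat) (F : alternating_shape n) (w : 'S_n).
Hypothesis n_ge2 : (2 <= n)%N.
Local Notation compatible :=
  (compatible (sweep F) (@interior n F) (left_position n_ge2 (F := F))
     (right_position n_ge2 (F := F))).

Lemma weak_leP (w1 w2 : 'S_n) :
  reflect (forall a b : 'I_n, (a < b)%N -> ((w1^-1)%g b < (w1^-1)%g a)%N ->
             ((w2^-1)%g b < (w2^-1)%g a)%N)
          (weak_le w1 w2).
Proof.
apply: (iffP forallP) => [le12 a b ab ba|le12 a].
  by have /forallP/(_ b) := le12 a; rewrite /inversion ab ba.
by apply/forallP=> b; apply/implyP=> /andP[ab /(le12 a b ab)]; rewrite /inversion ab.
Qed.

Lemma weak_intervalE pi : (pi \in weak_interval 1%g w) = weak_le pi w.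
Proof.
rewrite inE andb_idl // => _.
by apply/weak_leP => a b ab; rewrite invg1 !perm1 ltnNge (ltnW ab).
Qed.

Lemma mem_lin P pi : P \in reduced_pipe_dreams F w ->
  (pi \in lin w P) = weak_le pi w && compatible pi P.
Proof.
rewrite (reduced_pipe_dreamsE F n_ge2) inE => /and3P[legP _ _].
rewrite inE; apply/forallP/andP => [mono|[/weak_leP le_w /forallP comp] a].
  have {}mono a b : extended_contact_graph w P a b -> ((pi^-1)%g a < (pi^-1)%g b)%N.
    by have /forallP/(_ b)/implyP := mono a.
  split.
    apply/weak_leP=> a b ab ba; rewrite ltnNge; apply/negP => le_ab.
    have := mono a b.
    rewrite /extended_contact_graph /noninversion /inversion ab /= -leqNgt le_ab orbT.
    by move=> /(_ isT); rewrite ltnNge (ltnW ba).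
  apply/forallP=> c; apply/implyP=> /andP[ic cP]; apply: mono; apply/orP; left.
  by apply/(contact_graphP n_ge2 _ _ legP); exists c.
apply/forallP=> b; apply/implyP=> /orP[/(contact_graphP n_ge2 _ _ legP)[c [ic cP <- <-]]|].
  by have := comp c; rewrite ic cP.
rewrite /noninversion /inversion => /andP[ab]; rewrite ab /= -leqNgt => w_ab.
rewrite ltn_neqAle (inj_eq val_inj) (inj_eq perm_inj) neq_ltn ab /= leqNgt.
by apply/negP=> /(le_w a b ab); rewrite ltnNge w_ab.
Qed.

Lemma unique_lin P0 pi : P0 \in reduced_pipe_dreams F w -> weak_le pi w ->
  exists2 P, P \in strongly_acyclic_pipe_dreams F w &
    pi \in lin w P /\
    forall P', P' \in strongly_acyclic_pipe_dreams F w -> pi \in lin w P' -> P' = P.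
Proof.
move=> P0w pi_w.
have dreams_w : dreams (sweep F) (@interior n F) (left_position n_ge2 (F := F))
    (right_position n_ge2 (F := F)) w != set0.
  by rewrite -(reduced_pipe_dreamsE F n_ge2); apply/set0Pn; exists P0.
have [P] := compatible_dreams_unique (sweep_uniq F) (@mem_sweep n F)
  (positions_adjacent n_ge2 (F := F)) dreams_w (elimT (weak_leP pi w) pi_w).
rewrite inE -(reduced_pipe_dreamsE F n_ge2) => /andP[Pw Ppi] uniqP.
have pi_lin : pi \in lin w P by rewrite mem_lin // pi_w.
exists P; last split=> // P'.
  (* Strong acyclicity follows from [pi] being a linear extension: positions in [pi] would increase
     strictly around a cycle. *)
  rewrite inE Pw; apply/forallP=> a; apply/forallP=> b; apply/implyP=> ab.
  move: pi_lin; rewrite inE => /forallP mono.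
  have {}mono x y : extended_contact_graph w P x y -> ((pi^-1)%g x < (pi^-1)%g y)%N.
    by have /forallP/(_ y)/implyP := mono x.
  have mono_path x p : path (extended_contact_graph w P) x p ->
      ((pi^-1)%g x <= (pi^-1)%g (last x p))%N.
    elim: p x => //= y p IH x /andP[/mono xy /IH]; exact: leq_trans (ltnW xy).
  apply/negP => /connectP[p /mono_path + a_last]; rewrite -a_last leqNgt => /negP; apply.
  exact: mono.
rewrite inE => /andP[P'w _]; rewrite mem_lin // => /andP[_ P'pi].
by apply: uniqP; rewrite inE -(reduced_pipe_dreamsE F n_ge2) ?P'w ?Pw.
Qed.

End LinearExtensions.

Theorem theorem2p1 (n : nat) (F : alternating_shape n) (w : 'S_n)
    (n_ge2 : (2 <= n)%N) (w_sortable : sortable F w) :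
  {in strongly_acyclic_pipe_dreams F w &, injective (lin w)} /\
  partition [set lin w P | P in strongly_acyclic_pipe_dreams F w]
            (weak_interval 1%g w).
Proof.
have [P0 P0w] := set0Pn _ w_sortable.
have lin_le P pi : P \in strongly_acyclic_pipe_dreams F w -> pi \in lin w P -> weak_le pi w.
  by rewrite inE => /andP[Pw _]; rewrite (mem_lin n_ge2) // => /andP[].
have same P P' pi : P \in strongly_acyclic_pipe_dreams F w ->
    P' \in strongly_acyclic_pipe_dreams F w ->
    pi \in lin w P -> pi \in lin w P' -> P = P'.
  move=> Pw P'w piP piP'.
  have [Q _ [_ uniqQ]] := unique_lin n_ge2 P0w (lin_le _ _ Pw piP).
  exact: etrans (uniqQ P Pw piP) (esym (uniqQ P' P'w piP')).
(* Acyclicity provides a linear extension; as blocks are nonempty, equal blocks share an element and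
   so come from the same dream. *)
have nonempty P : P \in strongly_acyclic_pipe_dreams F w -> exists pi, pi \in lin w P.
  rewrite inE => /andP[_ /acyclic_linear_extension[pi mono]]; exists pi.
  by rewrite inE; apply/forallP=> a; apply/forallP=> b; apply/implyP/mono.
split.
  move=> P P' Pw P'w eq_lin; have [pi piP] := nonempty P Pw.
  by apply: (same _ _ _ Pw P'w piP); rewrite -eq_lin.
apply/and3P; split.
- apply/eqP/setP=> pi; rewrite weak_intervalE; apply/bigcupP/idP => [[A /imsetP[P Pw ->]]|pi_w].
    exact: lin_le.
  have [P Pw [piP _]] := unique_lin n_ge2 P0w pi_w.
  by exists (lin w P) => //; apply: imset_f.
- apply/trivIsetP=> _ _ /imsetP[P Pw ->] /imsetP[P' P'w ->] neq.
  rewrite -setI_eq0; apply: contraNT neq => /set0Pn[pi /setIP[piP piP']].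
  by apply/eqP; congr (lin w _); exact: (same _ _ _ Pw P'w piP piP').
- by apply/negP=> /imsetP[P Pw]; have [pi piP] := nonempty P Pw => /setP/(_ pi); rewrite inE piP.
Qed.
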